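(* Every non-discrete, locally minimal, locally precompact abelian group $G$ contains a super-sequence $S$ converging to $0$ such that $|S|=\chi(G)$. In particular, $\mathfrak{s}(G)=\chi(G)^+$.
   Context: All topological groups are Hausdorff. $\chi(X)$ denotes the character of a space $X$; by convention all cardinal invariants take infinite values (i.e. they are replaced by $\omega$ whenever they would be finite). $\kappa^+$ denotes the successor cardinal of $\kappa$. A topological group is locally precompact if it is topologically isomorphic to a subgroup of some locally compact group. A Hausdorff topological group $(G,\mathscr{T})$ is locally minimal if there exists $U\in\mathscr{T}$ with $1\in U$ such that $\mathscr{T}'=\mathscr{T}$ for every Hausdorff group topology $\mathscr{T}'\subseteq\mathscr{T}$ on $G$ for which $U$ is a $\mathscr{T}'$-neighborhood of $1$ (here $1$ is the identity element). An infinite Hausdorff space $S$ is a convergent super-sequence if it has a single non-isolated point $x$ and every neighbourhood of $x$ contains all but finitely many points of $S$; then $S$ is said to converge to $x$. A super-sequence in a space $X$ is a subspace of $X$ that is a convergent super-sequence. For a topological space $X$, $\mathfrak{s}(X)=\min\{\kappa: X$ has no convergent super-sequence of size $\ge\kappa\}$ (with $\kappa$ ranging over infinite cardinals). *)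

(* Defs.v *)
From HB Require Import structures.
From mathcomp Require Import all_boot all_order all_algebra.
From mathcomp Require Import all_classical all_reals all_analysis.

Set Implicit Arguments.
Unset Strict Implicit.
Unset Printing Implicit Defensive.

Import GRing.Theory.

Local Open Scope classical_set_scope.
Local Open Scope card_scope.

(* A cardinal is represented by any type of that cardinality: K <= L is
   [set: K] #<= [set: L], and equality of cardinals is [set: K] #= [set: L]. *)

Lemma card_leTTP (T U : Type) :
  [set: T] #<= [set: U] <-> exists f : T -> U, injective f.
Proof.
split=> [/card_leP[f]|[f finj]].
  pose i x : [set: T] := exist _ x (mem_setT x).
  exists (fun x => val (f (i x))) => x y /val_inj fxy.
  have /(congr1 val) // : i x = i y.
  by apply: 'inj_f fxy; rewrite in_setT.
have /injfunPex[g] : exists2 g : T -> U,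
    set_fun [set: T] [set: U] g & set_inj [set: T] g.
  by exists f => // x y _ _; exact: finj.
exact: inj_card_le.
Qed.

Definition is_least_card (P : Type -> Prop) (K : Type) : Prop :=
  P K /\ forall L : Type, P L -> [set: K] #<= [set: L].

Lemma ex_least_member (I : Type) (F : I -> Type) (i0 : I) :
  exists i, forall j, [set: F i] #<= [set: F j].
Proof.
(* A maximal subset of the product of all F i on which all the projections are
   injective projects bijectively onto one of the factors. *)
pose T := forall i : I, F i.
pose Q (A : set T) := forall f g, A f -> A g -> forall i, f i = g i -> f = g.
have [G GQ totG|A [QA maxA]] := @Zorn_bigcup T Q.
  move=> f g [X GX Xf] [Y GY Yg].
  by have [XY|YX] := totG _ _ GX GY; [apply: (GQ Y)|apply: (GQ X)] => //;
     [exact: XY|exact: YX].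
have [i iP] : exists i : I, forall x : F i, exists2 f, A f & f i = x.
  apply: contrapT => noi.
  have ex0 (i : I) : exists x : F i, forall f, A f -> f i <> x.
    apply: contrapT => nx; apply: noi; exists i => x.
    apply: contrapT => nf; apply: nx; exists x => f Af fx.
    by apply: nf; exists f.
  pose f0 : T := fun i => sval (cid (ex0 i)).
  have f0P i f : A f -> f i <> f0 i := svalP (cid (ex0 i)) f.
  apply: (maxA (A `|` [set f0])).
    split; first exact: subsetUl.
    by move=> /(_ f0 (or_intror erefl)) /(f0P i0).
  move=> f g [Af|->] [Ag|->] // j fg; first exact: QA fg.
    by case: (f0P j f Af).
  by case: (f0P j g Ag).
exists i => j.
pose h (x : F i) : F j := (s2val (cid2 (iP x))) j.
apply/card_leTTP; exists h.
move=> x y; rewrite /h; case: cid2 => f /= Af <-; case: cid2 => g /= Ag <-.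
by move=> /(QA f g Af Ag j) ->.
Qed.

Lemma ex_least_card (P : Type -> Prop) :
  (exists K, P K) -> exists K, is_least_card P K.
Proof.
move=> [K0 PK0].
pose I := {A : set K0 | exists2 K, P K & A #= [set: K]}.
have I0 : I by exists setT; exists K0; last exact: card_eqxx.
have [[A [K PK AK]] /= minA] := ex_least_member (fun i : I => set_type (sval i)) I0.
have KA : [set: K] #<= [set: A].
  rewrite (card_le_eqr (card_setT A)).
  by move: AK; rewrite card_eq_sym card_eq_le => /andP[].
exists K; split=> // L PL; apply: card_le_trans KA _.
have [[] /= le] := ex_least_member (fun b : bool => if b then K0 else L) true.
  apply: card_le_trans (le false); apply/card_leTTP.
  by exists set_val; exact: val_inj.
have /card_leTTP[f finj] := le true.
have fL : range f #= [set: L] by apply: inj_card_eq => x y _ _; exact: finj.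
have := minA (exist _ (range f) (ex_intro2 _ _ L PL fL)) => /=.
rewrite (card_le_eqr (card_setT (range f))) => /card_le_trans; apply.
by move: fL; rewrite card_eq_le => /andP[].
Qed.

(* The least cardinal satisfying P; by [ex_least_card] the default value is
   used only when no cardinal satisfies P. *)
Definition least_card (P : Type -> Prop) : Type :=
  if pselect (exists K, is_least_card P K) is left h then sval (cid h)
  else void.

Lemma least_cardP (P : Type -> Prop) :
  (exists K, P K) -> is_least_card P (least_card P).
Proof.
move=> /ex_least_card exK; rewrite /least_card.
by case: pselect => // h; exact: (svalP (cid h)).
Qed.

Definition succ_card (K : Type) : Type :=
  least_card (fun L => [set: K] #<= [set: L] /\ ~ ([set: L] #<= [set: K])).

Section cardinal_functions.
Context (X : topologicalType).

Definition local_base (x : X) (B : set (set X)) : Prop :=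
  (forall U, B U -> open_nbhs x U) /\
  (forall V, nbhs x V -> exists2 U, B U & U `<=` V).

Definition point_character (x : X) : Type :=
  least_card (fun K => exists2 B, local_base x B & B #= [set: K]).

(* sup of the characters at the points, made infinite by convention. *)
Definition character : Type :=
  least_card (fun K => infinite_set [set: K] /\
    forall x : X, [set: point_character x] #<= [set: K]).

End cardinal_functions.

Definition convergent_super_sequence (S : topologicalType) (x : S) : Prop :=
  [/\ infinite_set [set: S],
      hausdorff_space S,
      forall y : S, ~ isolated [set: S] y <-> y = x &
      forall U : set S, nbhs x U -> cofinite_set U].

(* Here S is turned into a type, with the subspace topology. *)
Definition super_sequence_to (X : topologicalType) (S : set X) (x : X) : Prop :=
  exists2 x' : S, set_val x' = x & convergent_super_sequence x'.

Definition super_sequence_number (X : topologicalType) : Type :=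
  least_card (fun K => infinite_set [set: K] /\
    ~ exists (S : set X) (x : X), super_sequence_to S x /\ [set: K] #<= S).

(* The minima above are attained. *)

Lemma cantor_not_le (T : Type) : ~ ([set: set T] #<= [set: T]).
Proof.
move=> /card_leTTP[f finj].
pose D := [set y | exists2 A : set T, f A = y & ~ A y].
have nD : ~ D (f D) by move=> DfD; case: (DfD) => A /finj -> /(_ DfD).
by apply: (nD); exists D.
Qed.

Lemma succ_cardP (K : Type) :
  is_least_card (fun L => [set: K] #<= [set: L] /\ ~ ([set: L] #<= [set: K]))
    (succ_card K).
Proof.
apply: least_cardP; exists (set K); split; last exact: cantor_not_le.
apply/card_leTTP; exists set1 => x y xy.
by have : [set x] x by []; rewrite xy.
Qed.

Lemma card_le_inl (T U : Type) : [set: T] #<= [set: T + U].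
Proof. by apply/card_leTTP; exists inl => x y []. Qed.

Lemma infinite_sum_nat (T : Type) : infinite_set [set: T + nat].
Proof.
have le : [set: nat] #<= [set: T + nat].
  by apply/card_leTTP; exists inr => x y [].
by move=> /(card_le_finite le); exact: infinite_nat.
Qed.

Lemma point_characterP (X : topologicalType) (x : X) :
  is_least_card (fun K => exists2 B, local_base x B & B #= [set: K])
    (point_character x).
Proof.
apply: least_cardP; exists (set_type (open_nbhs x)); exists (open_nbhs x).
  split=> // V; rewrite nbhsE => -[B oB BV]; by exists B.
exact: card_setT_sym.
Qed.

Lemma characterP (X : topologicalType) :
  is_least_card (fun K => infinite_set [set: K] /\
    forall x : X, [set: point_character x] #<= [set: K]) (character X).
Proof.
apply: least_cardP; exists (set X + nat)%type; split.
  exact: infinite_sum_nat.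
move=> x; apply: card_le_trans (card_le_inl (set X) nat).
have [[B _ BK] _] := point_characterP x.
apply: card_le_trans (card_leT B).
by move: BK; rewrite card_eq_sym card_eq_le => /andP[].
Qed.

Lemma super_sequence_numberP (X : topologicalType) :
  is_least_card (fun K => infinite_set [set: K] /\
      ~ exists (S : set X) (x : X), super_sequence_to S x /\ [set: K] #<= S)
    (super_sequence_number X).
Proof.
apply: least_cardP; exists (set X + nat)%type; split.
  exact: infinite_sum_nat.
move=> [S [x [_ le]]]; apply: (@cantor_not_le X).
exact: card_le_trans (card_le_inl _ nat) (card_le_trans le (card_leT S)).
Qed.

(* Not necessarily abelian topological groups; the abelian ones, written
   additively, are the library's [topologicalZmodType]. *)
HB.mixin Record Group_isTopologicalGroup H & Topological H & Group H := {
  mulg_continuous : continuous (fun p : H * H => (p.1 * p.2)%g) ;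
  invg_continuous : continuous (fun x : H => (x^-1)%g) ;
}.

#[short(type="topologicalGroupType")]
HB.structure Definition TopologicalGroup :=
  {H of Topological H & Group H & Group_isTopologicalGroup H}.

(* f is an isomorphism of G onto the subgroup [range f] of H, and a
   homeomorphism for the subspace topology on that subgroup. *)
Definition locally_precompact (G : topologicalZmodType) : Prop :=
  exists (H : topologicalGroupType) (f : G -> H),
    [/\ hausdorff_space H,
        locally_compact [set: H],
        {morph f : x y / (x + y)%R >-> (x * y)%g},
        injective f &
        forall A : set G, open A <-> exists2 B : set H, open B & A = f @^-1` B].

(* A second topology on the carrier of G is given by a class [Tc] of the
   library's topological structure; [Topological.Pack Tc] is G with it. *)
Definition group_topology (G : zmodType) (Tc : Topological G) : Prop :=
  let G' : topologicalType := Topological.Pack Tc in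
  continuous (fun p : G' * G' => (p.1 + p.2 : G)%R : G') /\
  continuous (fun x : G' => (- (x : G))%R : G').

Definition locally_minimal (G : topologicalZmodType) : Prop :=
  exists2 U : set G, open_nbhs (0%R : G) U &
    forall Tc : Topological G,
      let G' : topologicalType := Topological.Pack Tc in
      group_topology Tc ->
      hausdorff_space G' ->
      (@open G' `<=` @open G) ->
      nbhs (0%R : G') U ->
      @open G' = @open G.

(* Main.v *)
Require Import Defs.
From HB Require Import structures.
From mathcomp Require Import all_boot all_order all_algebra.
From mathcomp Require Import all_classical all_reals all_analysis.
From mathcomp Require Import Rstruct.
From mathcomp Require Import lra ring zify.
From mathcomp.real_closed Require Import complex.

(** Why the theorem holds.

    Let [f] embed [G] in a locally compact group [H], and let [K] be the closure
    of its image, an abelian group.  Neighbourhoods [W n] of 1 in [H] such that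
    [W n.+1 * (W n.+1)^-1 `<=` W n] meet in a compact subgroup [N] of [K], which
    can be taken as small as desired and has countable character in [K]; hence
    the character of [G] is that of [N], up to a countable factor.  Local
    minimality forces every closed subgroup [D] of [N] other than 1 to meet the
    image of [G] outside 1: otherwise the quotient by [D] would induce on [G] a
    strictly coarser Hausdorff group topology ([small_subgroup_trivial]).  So it
    is enough to find in [N] nontrivial closed subgroups [D i] that converge
    to 0, in the sense that every neighbourhood of 0 contains all but finitely
    many of them, and that are numerous enough to determine the topology of [N]
    ([spread_points]).  Nonzero points of [G] in the [D i] then converge to 0,
    each of them occurs for finitely many [i], and they form the super-sequence.
    If the [D i] are finitely many, [N] is metrizable, [G] is first countable,
    and an ordinary convergent sequence does.  No super-sequence is larger than
    the character, because its points outside a given neighbourhood of the limit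
    are finitely many ([super_sequence_card_le]).

    The subgroups [D i] come from Pontryagin duality.  The group [X] of
    continuous characters of [N] is generated by a subset [I] for which there is
    a homomorphism from [X] to the direct sum of copies of the circle indexed by
    [I] whose coordinate [F i] does not vanish at the character [i]
    ([spread_homs]); it is built one generator at a time, since the values
    forced on the multiples of a new generator have finite support and the
    circle is divisible.  Every [F i] is the evaluation at a point [y i] of [N]
    ([evaluation]), and [D i] is the closed subgroup generated by [y i].  A
    neighbourhood of 0 contains the common kernel of finitely many characters,
    and each of these vanishes at all but finitely many [y i].  Since [I]
    generates [X], it separates the points of [N] and determines its topology.

    Two facts about a compact abelian group [N] are needed.  Both use the
    invariant mean [M] of continuous functions, which is a uniform limit of
    averages of translates ([ex_mean_value]).

    Characters separate points ([ex_character]).  Fix [h] and consider the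
    functions [eta f], the convolution of [h] with the autocorrelation of a
    function [f] of norm 1.  Splitting [f] into [f + f(. + b)] and
    [f - f(. + b)] exhibits [eta f] as a convex combination of two functions of
    the same kind; as the energy [M (eta f ^+ 2)] is strictly convex, where it
    is maximal these are multiples of [eta f].  That is, [eta] satisfies
    [eta (x + b) + eta (x - b) = 2 * s b * eta x], so that [s] solves d'Alembert's
    functional equation for the cosine and is the real part of a character.  The
    maximum may fail to be attained by some [f], but the functions [eta f] are
    equicontinuous, so that they have limits, along an ultrafilter, to which the
    argument applies.  When [h] is a difference of translates
    [f0 (. + a) - f0], the character obtained is not trivial at [a].

    Every homomorphism [phi] from the character group to the circle is an
    evaluation.  By compactness it is enough to match finitely many values
    [phi (chi j)].  If no point did, the product over [j] of
    [2 + 2 * cos (chi j - phi (chi j))] would be bounded away from [4 ^ n], and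
    the means of its powers would be exponentially small compared with those of
    [4 ^ n].  But these means are at least the constant terms of the powers, a
    product of central binomial coefficients, which are smaller only by
    polynomial factors. *)

Set Implicit Arguments.
Unset Strict Implicit.
Unset Printing Implicit Defensive.

Import Order.TTheory GRing.Theory Num.Theory.
Import numFieldNormedType.Exports.

Local Open Scope classical_set_scope.
Local Open Scope card_scope.

(** * Arithmetic of infinite cardinals *)

Lemma card_le_total (T U : Type) :
  [set: T] #<= [set: U] \/ [set: U] #<= [set: T].
Proof.
have [[] le] := ex_least_member (fun b : bool => if b then T else U) true.
  by left; exact: (le false).
by right; exact: (le true).
Qed.

Section infinite_square.
Variable A : Type.

Let dom (D : set ((A * A) * A)) : set A := [set a | exists b c, D ((a, b), c)].

(** [D] is the graph of an injection [B * B -> B], for a subset [B] of [A]. *)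
Let square_injection (D : set ((A * A) * A)) :=
  [/\ forall p c c', D (p, c) -> D (p, c') -> c = c',
      forall p p' c, D (p, c) -> D (p', c) -> p = p',
      forall a b c, D ((a, b), c) -> [/\ dom D a, dom D b & dom D c] &
      forall a b, dom D a -> dom D b -> exists c, D ((a, b), c)].

Lemma square_injection_chain (D0 : set ((A * A) * A)) (F : set (set ((A * A) * A))) :
  square_injection D0 -> F `<=` (fun D => square_injection (D0 `|` D)) ->
  total_on F subset -> square_injection (D0 `|` \bigcup_(X in F) X).
Proof.
move=> D0P FP totF; set U := D0 `|` _.
have pair e1 e2 : U e1 -> U e2 ->
    exists D, [/\ square_injection D, D `<=` U, D e1 & D e2].
  have inU X : F X -> D0 `|` X `<=` U.
    by move=> FX e [De|Xe]; [left|right; exists X].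
  move=> [D1|[X FX X1]] [D2|[Y FY Y2]].
  - by exists D0; split=> // e De; left.
  - exists (D0 `|` Y); split; [exact: FP|exact: inU|by left|by right].
  - exists (D0 `|` X); split; [exact: FP|exact: inU|by right|by left].
  - have [XY|YX] := totF _ _ FX FY.
      exists (D0 `|` Y); split; [exact: FP|exact: inU| |by right].
      by right; exact: XY.
    exists (D0 `|` X); split; [exact: FP|exact: inU|by right|].
    by right; exact: YX.
split.
- by move=> p c c' pc pc'; have [D [[fD _ _ _] _ Dc Dc']] := pair _ _ pc pc';
    exact: fD Dc Dc'.
- by move=> p p' c pc pc'; have [D [[_ iD _ _] _ Dc Dc']] := pair _ _ pc pc';
    exact: iD Dc Dc'.
- move=> a b c abc; have [D [[_ _ cD _] DU /cD[da db dc] _]] := pair _ _ abc abc.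
  have dU x : dom D x -> dom U x by move=> [y [z xyz]]; exists y, z; exact: DU.
  by split; exact: dU.
- move=> a b [a' [a'' aa]] [b' [b'' bb]].
  have [D [[_ _ _ tD] DU Da Db]] := pair _ _ aa bb.
  have [c abc] : exists c, D ((a, b), c).
    by apply: tD; [exists a', a''|exists b', b''].
  by exists c; exact: DU.
Qed.

(** Hessenberg's theorem.  Let [B] carry a maximal square injection extending
    that of a countable subset.  If the complement of [B] were at least as large
    as [B], it would contain a copy [h B] of [B], and the injection would extend
    to [B] together with [h B], whose square consists of four copies of [B * B].
    Otherwise [A] embeds in the union of two copies of [B], hence in [B]. *)
Lemma infinite_square : infinite_set [set: A] ->
  exists j : A * A -> A, injective j.
Proof.
move=> /infiniteP/card_leTTP[i iinj].
pose D0 : set ((A * A) * A) :=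
  [set q | exists m n, q = ((i m, i n), i (pickle (m, n)))].
have domD0 n : dom D0 (i n) by exists (i n), (i (pickle (n, n))), n, n.
have D0P : square_injection D0.
  split.
  - move=> _ _ _ [m [n [-> ->]]] [m' [n' [/iinj mm /iinj nn ->]]].
    by rewrite mm nn.
  - move=> _ _ _ [m [n [-> ->]]] [m' [n' [-> /iinj]]].
    by move=> /(pcan_inj pickleK)[-> ->].
  - by move=> _ _ _ [m [n [-> -> ->]]]; split; exact: domD0.
  - move=> _ _ [? [? [m [? [-> _ _]]]]] [? [? [n [? [-> _ _]]]]].
    by exists (i (pickle (m, n))), m, n.
have [G [GP Gmax]] := Zorn_bigcup (fun F => @square_injection_chain D0 F D0P).
set D := D0 `|` G in GP.
have [fD iD cD tD] := GP.
pose B := dom D.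
have Bi n : B (i n) by case: (domD0 n) => b [c nbc]; exists b, c; left.
have /choice[j jP'] : forall p, exists c, B p.1 -> B p.2 -> D (p, c).
  move=> [a b] /=; have [[Ba Bb]|nB] := pselect (B a /\ B b).
    by have [c abc] := tD _ _ Ba Bb; exists c.
  by exists (i 0%N) => Ba Bb; case: nB.
have jP a b : B a -> B b -> D ((a, b), j (a, b)) by exact: (jP' (a, b)).
have jB a b : B a -> B b -> B (j (a, b)).
  by move=> Ba Bb; case: (cD _ _ _ (jP _ _ Ba Bb)).
have jinj a b a' b' : B a -> B b -> B a' -> B b' ->
    j (a, b) = j (a', b') -> a = a' /\ b = b'.
  move=> Ba Bb Ba' Bb' jj; have := jP _ _ Ba Bb; rewrite jj => Dab.
  by have [] := iD _ _ _ Dab (jP _ _ Ba' Bb').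
have [/card_leTTP[h hinj]|/card_leTTP[k kinj]] :=
    card_le_total {a | B a} {a | ~ B a}.
  have {h hinj}[h nB hinj] : exists2 h : A -> A, forall a, B a -> ~ B (h a) &
      forall a b, B a -> B b -> h a = h b -> a = b.
    exists (fun a => if pselect (B a) is left Ba then sval (h (exist _ a Ba)) else a).
      by move=> a Ba; case: pselect => // Ba'; case: (h _).
    move=> a b Ba Bb; case: pselect => // Ba'; case: pselect => // Bb'.
    by move=> /eq_sig_hprop hh; have [] : exist B a Ba' = exist B b Bb'
      by apply/hinj/hh => x; exact: Prop_irrelevance.
(* Two bits tell the copies apart: [s u] is the identity of [B] or [h], and
     [e u v] tags the four squares. *)
  pose s (u : bool) a := if u then h a else a.
  pose e (u v : bool) := i (u + v.*2)%N.
  pose w (u v : bool) a b :=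
    if u || v then h (j (e u v, j (a, b))) else j (a, b).
  have sinj u u' a a' : B a -> B a' -> s u a = s u' a' -> u = u' /\ a = a'.
    case: u u' => [] [] Ba Ba' //=.
    - by move=> /hinj -> .
    - by move=> ha; case: (nB _ Ba); rewrite ha.
    - by move=> ha; case: (nB _ Ba'); rewrite -ha.
  pose D' : set ((A * A) * A) := [set q | exists u v a b,
    [/\ B a, B b & q = ((s u a, s v b), w u v a b)]].
  have domD' u a : B a -> dom D' (s u a).
    by move=> Ba; exists (s u a), (w u u a a), u, u, a, a.
  have DD' : D `<=` D'.
    move=> [[a b] c] abc; have [Ba Bb Bc] := cD _ _ _ abc.
    exists false, false, a, b; split=> //=; congr (_, _).
    exact: fD abc (jP _ _ Ba Bb).
  case: (Gmax D').
    split; first by move=> x Gx; apply: DD'; right.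
    move=> /(_ ((h (i 0), h (i 0)), w true true (i 0) (i 0)))%N D'G.
    case: (nB (i 0%N)) => //; exists (h (i 0%N)), (w true true (i 0%N) (i 0%N)).
    by right; apply: D'G; exists true, true, (i 0%N), (i 0%N).
  suff -> : D0 `|` D' = D'; last by apply/setUidPr => x D0x; apply: DD'; left.
  split.
  - move=> p c c' [u [v [a [b [Ba Bb [-> ->]]]]]] [u' [v' [a' [b' [Ba' Bb']]]]].
    by move=> [/(sinj _ _ _ _ Ba Ba')[-> ->] /(sinj _ _ _ _ Bb Bb')[-> ->] ->].
  - move=> p p' c [u [v [a [b [Ba Bb [-> ->]]]]]] [u' [v' [a' [b' [Ba' Bb' [->]]]]]].
    have Be x y : B (e x y) by exact: Bi.
    rewrite /w; case: ifPn => uv; case: ifPn => uv'.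
    + move=> /hinj => /(_ (jB _ _ (Be _ _) (jB _ _ Ba Bb))).
      move=> /(_ (jB _ _ (Be _ _) (jB _ _ Ba' Bb'))) /jinj [] //; try exact: jB.
      move=> /iinj uvE /jinj[] // -> ->.
      by move: uvE {uv uv'}; case: u u' v v' => [] [] [] [].
    + move=> hj; case: (nB (j (e u v, j (a, b)))).
        by apply: (jB) => //; exact: jB.
      by rewrite hj; exact: jB.
    + move=> hj; case: (nB (j (e u' v', j (a', b')))).
        by apply: (jB) => //; exact: jB.
      by rewrite -hj; exact: jB.
    + by move=> /jinj[] // -> ->; move: uv uv'; case: u u' v v' => [] [] [] [].
  - move=> _ _ _ [u [v [a [b [Ba Bb [-> -> ->]]]]]]; split; [exact: domD'|exact: domD'|].
    rewrite /w; case: ifP => _; last by apply: (domD' false); exact: jB.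
    by apply: (domD' true); apply: (jB); [exact: Bi|exact: jB].
  - move=> x y [? [? [u [? [a [? [Ba _ [-> _ _]]]]]]]].
    move=> [? [? [v [? [b [? [Bb _ [-> _ _]]]]]]]].
    by exists (w u v a b), u, v, a, b.
pose l a := if pselect (B a) is right nBa then j (i 1%N, sval (k (exist _ a nBa)))
  else j (i 0%N, a).
have lB a : B (l a).
  rewrite /l; case: pselect => [Ba|nBa]; apply: (jB) => //; exact: svalP.
have kB x : B (sval (k x)) by exact: svalP.
have linj : injective l.
  move=> a b; rewrite /l; case: pselect => [Ba|nBa]; case: pselect => [Bb|nBb] lab.
  - by have [] := jinj _ _ _ _ (Bi 0%N) Ba (Bi 0%N) Bb lab.
  - by have [/iinj] := jinj _ _ _ _ (Bi 0%N) Ba (Bi 1%N) (kB _) lab.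
  - by have [/iinj] := jinj _ _ _ _ (Bi 1%N) (kB _) (Bi 0%N) Bb lab.
  - have [_ /eq_sig_hprop kk] := jinj _ _ _ _ (Bi 1%N) (kB _) (Bi 1%N) (kB _) lab.
    have [] // : exist (fun x => ~ B x) a nBa = exist _ b nBb.
    by apply/kinj/kk => x; exact: Prop_irrelevance.
exists (fun p => j (l p.1, l p.2)) => -[a b] [a' b'] /=.
by move=> /(jinj _ _ _ _ (lB _) (lB _) (lB _) (lB _))[/linj -> /linj ->].
Qed.

End infinite_square.

Section infinite_arithmetic.
Variable K : Type.
Hypothesis Kinf : infinite_set [set: K].

Lemma card_nat_le : [set: nat] #<= [set: K].
Proof. exact/infiniteP. Qed.

Lemma card_prod_le (T U : Type) : [set: T] #<= [set: K] ->
  [set: U] #<= [set: K] -> [set: T * U] #<= [set: K].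
Proof.
move=> /card_leTTP[f finj] /card_leTTP[g ginj].
have [j jinj] := infinite_square Kinf.
apply/card_leTTP; exists (fun p => j (f p.1, g p.2)) => -[a b] [a' b'] /=.
by move=> /jinj[/finj -> /ginj ->].
Qed.

Lemma card_sum_le (T U : Type) : [set: T] #<= [set: K] ->
  [set: U] #<= [set: K] -> [set: T + U] #<= [set: K].
Proof.
move=> /card_leTTP[f finj] /card_leTTP[g ginj].
have boolK : [set: bool] #<= [set: K].
  by apply: card_le_trans card_nat_le; apply/card_leTTP; exists nat_of_bool => -[] [].
apply: card_le_trans (card_prod_le boolK (card_lexx [set: K])).
apply/card_leTTP.
exists (fun s => match s with inl t => (true, f t) | inr u => (false, g u) end).
by move=> [t|u] [t'|u'] //= [] => [/finj|/ginj] ->.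
Qed.

(** A finite sequence is coded by its size and by iterated pairing. *)
Lemma card_seq_le (T : Type) : [set: T] #<= [set: K] ->
  [set: seq T] #<= [set: K].
Proof.
move=> /card_leTTP[f finj]; have [j jinj] := infinite_square Kinf.
have /card_leTTP[i iinj] := card_nat_le.
apply: card_le_trans (card_prod_le card_nat_le (card_lexx [set: K])).
apply/card_leTTP; pose enc := foldr (fun t k => j (f t, k)) (i 0%N).
exists (fun s => (size s, enc s)).
by elim=> [|t s IHs] [|t' s'] //= [ss] /jinj[/finj -> es];
  have -> : s = s' by apply: IHs; rewrite ss es.
Qed.

(** Each fibre is finite, hence countable, and [K * nat] embeds in [K]. *)
Lemma card_le_finite_fibres (T U : Type) (f : T -> U) :
  (forall u, finite_set (f @^-1` [set u])) -> [set: U] #<= [set: K] ->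
  [set: T] #<= [set: K].
Proof.
move=> ffin UK.
have /choice[g gP] u : exists g : T -> nat, {in f @^-1` [set u] &, injective g}.
  by have /finite_set_countable/countable_injP := ffin u.
apply: card_le_trans (card_prod_le UK card_nat_le).
apply/card_leTTP; exists (fun t => (f t, g (f t) t)) => t t' [ft].
by rewrite ft; apply: gP; rewrite inE /= ?ft.
Qed.

End infinite_arithmetic.

(** * Super-sequences *)

Lemma nbhs_set_type (X : topologicalType) (A : set X) (a : A) (U : set A) :
  nbhs a U <-> exists2 V : set X, nbhs (set_val a) V & set_val @^-1` V `<=` U.
Proof.
split=> [|[V aV VU]].
  rewrite nbhsE => -[_ [[V oV <-] Va] VU]; exists V => //.
  by exists V.
apply: filterS VU _; exact: (@initial_continuous A X set_val).
Qed.

(** A super-sequence converging to [x] is covered by [x] and by the finite sets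
    of its points outside the members of a local base at [x]. *)
Lemma super_sequence_card_le (X : topologicalType) (S : set X) (x : X) (K : Type) :
  infinite_set [set: K] -> [set: point_character x] #<= [set: K] ->
  super_sequence_to S x -> S #<= [set: K].
Proof.
move=> Kinf xK [x' x'x [Sinf hS iso cof]].
have [[B [Bopen Bbase] BK] _] := point_characterP x.
have BleK : [set: set_type B] #<= [set: K].
  by rewrite (card_le_eql (card_setT B)) (card_le_eql BK).
have /choice[b bP] (s : {s : S | s <> x'}) :
    exists U : set_type B, ~ set_val U (set_val (sval s)).
  case: s => s sx /=.
  have [V [V' [xV sV' VV']]] : exists V V', [/\ nbhs x' V, nbhs s V' & ~ (V `&` V' !=set0)].
    apply: contrapT => nV; apply: sx; apply/esym/hS => V V' xV sV'.
    by apply: contrapT => nVV'; apply: nV; exists V, V'.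
  have /nbhs_set_type[W] := xV; rewrite x'x => /Bbase[U BU UW] WV.
  exists (exist _ U (mem_set BU)) => /= Us; apply: VV'; exists s; split.
    by apply: WV; exact: UW.
  exact: nbhs_singleton.
have SleK : [set: {s : S | s <> x'}] #<= [set: K].
  apply: (card_le_finite_fibres Kinf (f := b)) BleK => U.
  have BU : B (set_val U) by exact: set_valP.
  have fin : finite_set (~` (set_val @^-1` (set_val U) : set S)).
    apply: cof; apply/nbhs_set_type; exists (set_val U) => //; rewrite x'x.
    by apply: open_nbhs_nbhs; exact: Bopen.
  have inj : set_inj (sval @^-1` (~` (set_val @^-1` (set_val U) : set S)))
      (@sval _ (fun s : S => s <> x')).
    by move=> [s sx] [t tx] _ _ /= st; apply: eq_exist.
  apply: sub_finite_set (finite_preimage inj fin) => s /= bs; rewrite -bs; exact: bP.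
rewrite -(card_le_eql (card_setT S)).
have unitK : [set: unit] #<= [set: K].
  apply: card_le_trans (card_nat_le Kinf).
  by apply/card_leTTP; exists (fun=> 0%N) => -[] [].
apply: card_le_trans (card_sum_le Kinf SleK unitK); apply/card_leTTP.
exists (fun s => if pselect (s = x') is right n then inl (exist _ s n) else inr tt).
move=> s t; case: pselect => [->|ns]; case: pselect => [->|nt] //.
by case.
Qed.

(** The set of the [g j] is as large as [J], because each point avoids some
    neighbourhood of [x] and thus has finitely many indices. *)
Lemma super_sequence_of_family (X : topologicalType) (x : X) (J : Type) (g : J -> X) :
  hausdorff_space X -> infinite_set [set: J] -> (forall j, g j <> x) ->
  (forall V, nbhs x V -> finite_set [set j | ~ V (g j)]) ->
  exists S : set X, [/\ super_sequence_to S x, infinite_set [set: set_type S] &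
    [set: J] #<= [set: set_type S]].
Proof.
move=> hX Jinf gx gV; pose S := x |` range g.
have Sx : S x by left.
have Sg j : S (g j) by right; exists j.
pose x' : S := exist _ x (mem_set Sx); pose g' j : S := exist _ (g j) (mem_set (Sg j)).
have sep y : y <> x -> exists2 V, nbhs x V & ~ V y.
  move=> yx; apply: contrapT => nV; apply: yx; apply/esym/hX => A B xA yB.
  exists y; split; last exact: nbhs_singleton.
  by apply: contrapT => Ay; apply: nV; exists A.
have fib (u : S) : finite_set (g' @^-1` [set u]).
  have [ux|/sep[V xV nVu]] := pselect (set_val u = x).
    rewrite (_ : _ @^-1` _ = set0) //; apply/seteqP; split=> // j /= ju.
    by case: (gx j); rewrite -ux -ju.
  by apply: sub_finite_set (gV V xV) => j /= ju; rewrite -ju in nVu.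
have Sinf : infinite_set [set: S].
  move=> Sfin; apply: Jinf; rewrite (_ : setT = \bigcup_(u in [set: S]) (g' @^-1` [set u])).
    exact: bigcup_finite.
  by apply/seteqP; split=> // j _; exists (g' j).
have cof (U : set S) : nbhs x' U -> cofinite_set U.
  move=> /nbhs_set_type[V xV VU].
  apply: sub_finite_set (finite_image g' (gV V xV)) => u nUu.
  have nVu : ~ V (set_val u) by move=> Vu; apply: nUu; exact: VU.
  case: u nUu nVu => u Su _ nVu0; have nVu : ~ V u := nVu0.
  have [ux|[j _ ju]] := set_mem Su.
    by case: nVu; rewrite ux; exact: nbhs_singleton.
  by exists j; [rewrite /= ju|apply: eq_exist].
exists S; split=> //; last exact: (card_le_finite_fibres Sinf fib (card_lexx _)).
have hS : hausdorff_space S.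
  move=> a b ab; apply: val_inj; apply: hX => A B aA bB.
  have [c [Ac Bc]] := ab (set_val @^-1` A) (set_val @^-1` B)
    ((nbhs_set_type _ _).2 (ex_intro2 _ _ A aA (fun _ => id)))
    ((nbhs_set_type _ _).2 (ex_intro2 _ _ B bB (fun _ => id))).
  by exists (set_val c).
exists x' => //; split=> //.
move=> y; split=> [niso|-> [_ [V xV]]].
  apply: contrapT => yx'; apply: niso; split; first by rewrite inE.
  have yx : set_val y <> x by move=> yx; apply: yx'; apply: val_inj.
  have [V [V' [xV yV' VV']]] : exists V V', [/\ nbhs x' V, nbhs y V' & ~ (V `&` V' !=set0)].
    apply: contrapT => nV; apply: yx'; apply/esym/hS => A B xA yB.
    by apply: contrapT => nAB; apply: nV; exists A, B.
  have fin : finite_set (~` V `&` ~` [set y]).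
    by apply: sub_finite_set (cof _ xV) => u [].
  have acc : accessible_space S by exact: hausdorff_accessible.
  have clF := (@accessible_finite_set_closed S).1 acc _ fin.
  exists (V' `&` ~` (~` V `&` ~` [set y])).
    apply: filterI => //; apply: open_nbhs_nbhs; split; first exact: closed_openC.
    by move=> [_]; apply.
  rewrite setIT; apply/seteqP; split=> [u [V'u nu]|_ ->]; last first.
    by split; [exact: nbhs_singleton|move=> [_]; apply].
  apply: contrapT => uy; apply: nu; split=> // Vu; apply: VV'; by exists u.
rewrite setIT => Vx; apply: Sinf.
have /cof := xV; rewrite Vx => fin.
rewrite -(setvU [set x']) finite_setU; split=> //; exact: finite_set1.
Qed.

Local Open Scope ring_scope.

(** * Homomorphisms to direct sums of divisible groups *)

Definition subgroup_set (X : zmodType) (B : set X) :=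
  B 0 /\ forall x y, B x -> B y -> B (x - y).

Section subgroup_set_theory.
Variables (X : zmodType) (B : set X).
Hypothesis BP : subgroup_set B.

Lemma subgroup_setN x : B x -> B (- x).
Proof. by have [B0 BB] := BP; move=> Bx; rewrite -sub0r; exact: BB. Qed.

Lemma subgroup_setD x y : B x -> B y -> B (x + y).
Proof.
by have [_ BB] := BP; move=> Bx /subgroup_setN By; rewrite -[y]opprK; exact: BB.
Qed.

Lemma subgroup_setMn x n : B x -> B (x *+ n).
Proof.
move=> Bx; elim: n => [|n IHn]; first by have [B0] := BP.
by rewrite mulrS; exact: subgroup_setD.
Qed.

Lemma subgroup_setMz x (k : int) : B x -> B (x *~ k).
Proof.
by case: k => n Bx; [exact: subgroup_setMn|exact/subgroup_setN/subgroup_setMn].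
Qed.

Lemma subgroup_set_sum (I : Type) (r : seq I) (F : I -> X) :
  (forall i, B (F i)) -> B (\sum_(i <- r) F i).
Proof.
move=> BF; elim/big_ind: _ => //; first by have [] := BP.
exact: subgroup_setD.
Qed.

End subgroup_set_theory.

Lemma mulrz_pair (X Y : zmodType) (x : X) (y : Y) (k : int) :
  (x, y) *~ k = (x *~ k, y *~ k).
Proof.
have natE n : (x, y) *+ n = (x *+ n, y *+ n).
  by elim: n => [|n IHn] //; rewrite !mulrS IHn.
by case: k => n; rewrite ?NegzE ?mulrNz -!pmulrn natE.
Qed.

Lemma mulrz_fct (T : Type) (Y : zmodType) (f : T -> Y) (k : int) t :
  (f *~ k) t = f t *~ k.
Proof.
by case: k => n; rewrite ?NegzE ?mulrNz -!pmulrn ?opprfctE natmulfctE.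
Qed.

Section spread_homs.
Variables (X D : zmodType) (C : set X).
Hypothesis CP : subgroup_set C.
Hypothesis D_divisible : forall (d : D) n, (0 < n)%N -> exists e, e *+ n = d.
Hypothesis D_torsion :
  forall n, (1 < n)%N -> exists e : D, e <> 0 /\ e *+ n = 0.

(** The indices at which some element of the partial homomorphism has a nonzero
    coordinate named by itself. *)
Let diag (G : set (X * (X -> D))) : set X :=
  [set i | exists2 u, G (i, u) & u i <> 0].

(** The graphs of the partial homomorphisms from [C] to the functions of finite
    support with values in [D], such that the elements [i] at which the
    coordinate [i] does not vanish contain all supports and generate the
    domain. *)
Let good (G : set (X * (X -> D))) :=
  [/\ forall p q, G p -> G q -> G (p - q),
      forall u, G (0, u) -> u = 0,
      forall p, G p -> [/\ C p.1, finite_set [set i | p.2 i <> 0] &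
        forall i, p.2 i <> 0 -> diag G i] &
      forall B, subgroup_set B -> diag G `<=` B -> forall p, G p -> B p.1].

Let good_chain (F : set (set (X * (X -> D)))) :
  F `<=` good -> total_on F subset -> good (\bigcup_(G in F) G).
Proof.
move=> FP totF; set U := \bigcup_(G in F) G.
have dU G : F G -> diag G `<=` diag U.
  by move=> FG i [u Gu ui]; exists u => //; exists G.
split.
- move=> p q [G FG Gp] [H FH Hq].
  have [GH|HG] := totF _ _ FG FH.
    by exists H => //; have [+ _ _ _] := FP _ FH; apply=> //; exact: GH.
  by exists G => //; have [+ _ _ _] := FP _ FG; apply=> //; exact: HG.
- by move=> u [G FG Gu]; have [_ + _ _] := FP _ FG; apply.
- move=> p [G FG Gp]; have [_ _ /(_ _ Gp)[Cp fp sp] _] := FP _ FG.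
  by split=> // i /sp; exact: dU.
- move=> B BP UB p [G FG Gp]; have [_ _ _] := FP _ FG; apply => //.
  by apply: subset_trans UB; exact: dU.
Qed.

(** The value [v] at a new element [x] is only constrained by the multiples of
    [x] in the domain, which are those of the least positive one, if any.  Then
    [v] is obtained by division, up to a torsion element which is used to make
    [v x] nonzero: the coordinate [x] is still unused, because [x] is not in the
    domain. *)
Let ex_extension_value (G : set (X * (X -> D))) x : good G -> G 0 -> C x ->
  ~ (exists u, G (x, u)) ->
  exists v : X -> D, [/\ v x <> 0, finite_set [set i | v i <> 0],
    forall i, v i <> 0 -> i = x \/ diag G i &
    forall k : int, (exists u, G (x *~ k, u)) -> G ((x, v) *~ k)].
Proof.
move=> GP G0 Cx xG; have [GB Gu GC Gd] := GP.
have GS : subgroup_set G by [].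
pose domn n := `[< (0 < n)%N /\ exists u, G (x *+ n, u) >].
have [nex|exn] := pselect (~ exists n, domn n).
  have [t [t0 _]] := @D_torsion 2 isT.
  exists (fun i => if i == x then t else 0); split.
  - by rewrite eqxx.
  - apply: (@sub_finite_set _ _ [set x]) => [i /=|]; last exact: finite_set1.
    by case: eqVneq.
  - by move=> i; case: eqVneq => // ->; left.
  - move=> k [u]; have [->|k0] := eqVneq k 0; first by rewrite mulr0z.
    move=> Gk; case: nex; exists `|k|%N; apply/asboolP; split.
      by rewrite absz_gt0.
    case: k k0 Gk => n _ Gk; first by exists u.
    exists (- u); suff -> : (x *+ `|Negz n|, - u) = - (x *~ Negz n, u).
      exact: subgroup_setN.
    by congr (_, _) => /=; rewrite NegzE mulrNz opprK.
move/contrapT : exn => /ex_minnP[n /asboolP[n0 [u Gxn]] nmin].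
have n1 : (1 < n)%N.
  rewrite ltn_neqAle n0 andbT; apply: contra_notN xG => /eqP n1.
  by exists u; move: Gxn; rewrite -n1.
have [t [t0 tn]] := D_torsion n1.
have ux : u x = 0.
  apply: contrapT => ux; apply: xG; have [_ _ /(_ x ux)[w Gw _]] := GC _ Gxn.
  by exists w.
have /choice[v vP] i : exists e, [/\ e *+ n = u i, i = x -> e = t &
    u i = 0 -> i <> x -> e = 0].
  have [->|/eqP ix] := eqVneq i x; first by exists t; rewrite tn ux; split.
  have [ui|ui] := pselect (u i = 0); first by exists 0; rewrite mul0rn ui; split.
  by have [e eP] := D_divisible (u i) n0; exists e; split.
have vx : v x = t by have [_ ->] := vP x.
have sv i : v i <> 0 -> i = x \/ u i <> 0.
  move=> vi; have [|/eqP ix] := eqVneq i x; first by left.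
  by right=> ui; apply: vi; have [_ _ ->] := vP i.
exists v; split.
- by rewrite vx.
- apply: (@sub_finite_set _ _ ([set x] `|` [set i | u i <> 0])).
    by move=> i /sv[->|]; [left|right].
  by rewrite finite_setU; split; [exact: finite_set1|have [_ ? _] := GC _ Gxn].
- by move=> i /sv[|ui]; [left|right; have [_ _] := GC _ Gxn; exact].
- move=> k [w Gk].
  have Gv : G ((x, v) *+ n).
    rewrite pmulrn mulrz_pair -!pmulrn; suff -> : v *+ n = u by [].
    by apply/funext => i; rewrite natmulfctE; have [] := vP i.
  rewrite (divz_eq k n) mulrzDr; set q := (k %/ n)%Z.
  have Gqn : G ((x, v) *~ (q * n)).
    by rewrite [q * n]mulrC mulrzA -pmulrn; exact: subgroup_setMz.
  have n0z : n%:Z != 0 by rewrite eqz_nat -lt0n.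
  have r0 : (0 <= k %% n)%Z by exact: modz_ge0.
  have := ltz_mod k n0z; move: r0.
  case rE : (k %% n)%Z => [r|//] _; rewrite gtr0_norm ?ltz_nat // => rn.
  suff -> : r = 0%N by rewrite mulr0z addr0.
  apply/eqP; apply: contraLR rn; rewrite -lt0n -leqNgt => r0; apply: nmin.
  apply/asboolP; split=> //; exists (w - v *~ (q * n)).
  suff -> : (x *+ r, w - v *~ (q * n)) = (x *~ k, w) - (x, v) *~ (q * n).
    exact: GB.
  rewrite mulrz_pair; congr (_, _) => /=.
  by rewrite -mulrzBr {1}(divz_eq k n) rE -/q addrC addKr.
Qed.

Let good_extension (G : set (X * (X -> D))) x v : good G -> G 0 -> C x ->
    v x <> 0 -> finite_set [set i | v i <> 0] ->
    (forall i, v i <> 0 -> i = x \/ diag G i) ->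
    (forall k : int, (exists u, G (x *~ k, u)) -> G ((x, v) *~ k)) ->
  good [set p | exists2 q, G q & exists k : int, p = q + (x, v) *~ k].
Proof.
move=> GP G0 Cx vx finv sv xv; have [GB Gu GC Gd] := GP.
have GS : subgroup_set G by [].
set G' := (X in good X).
have GG' : G `<=` G' by move=> p Gp; exists p => //; exists 0; rewrite mulr0z addr0.
have G'x : G' (x, v) by exists 0 => //; exists 1; rewrite add0r.
have dG : diag G `<=` diag G' by move=> i [u /GG' Gu' ui]; exists u.
have dx : diag G' x by exists v.
split.
- move=> _ _ [p Gp [k ->]] [q Gq [l ->]]; exists (p - q); first exact: GB.
  by exists (k - l); rewrite mulrzBr opprD addrACA.
- move=> u [[y w] Gyw [k]]; rewrite mulrz_pair => -[/esym/eqP].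
  rewrite addr_eq0 => /eqP yE ->.
  have Gxk : G ((x, v) *~ (- k)).
    by apply: xv; exists w; move: Gyw; rewrite yE mulrNz.
  have := GB _ _ Gyw Gxk; rewrite mulrz_pair mulrNz yE => /=.
  have -> : (- (x *~ k), w) - (- (x *~ k), v *~ - k) = (0, w + v *~ k).
    by congr (_, _) => /=; rewrite ?subrr // mulrNz opprK.
  exact: Gu.
- move=> _ [[y w] Gyw [k ->]]; have [Cy finw sw] := GC _ Gyw.
  rewrite mulrz_pair; split => /=.
  + by apply: subgroup_setD => //; exact: subgroup_setMz.
  + apply: (@sub_finite_set _ _ ([set i | w i <> 0] `|` [set i | v i <> 0])); last first.
      by rewrite finite_setU.
    move=> i /= wvi; apply: contrapT => /not_orP[/contrapT wi /contrapT vi].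
    by apply: wvi; rewrite addrfctE wi add0r mulrz_fct vi mul0rz.
  + move=> i wvi; have [wi|/sw] := pselect (w i = 0); last exact: dG.
    have [vi|/sv[->|]//] := pselect (v i = 0); last exact: dG.
    by case: wvi; rewrite addrfctE wi add0r mulrz_fct vi mul0rz.
- move=> B BP dB _ [p Gp [k ->]].
  have Bp : B p.1 by apply: Gd Gp => //; exact: subset_trans dB.
  rewrite mulrz_pair /=; apply: (subgroup_setD BP) => //.
  by apply: (subgroup_setMz BP); exact: dB.
Qed.

(** An element [x] outside the domain of a maximal partial homomorphism could be
    added to it, as one more index. *)
Lemma spread_homs : exists (I : set X) (F : X -> X -> D),
  [/\ I `<=` C,
      forall i, I i -> F i i <> 0,
      forall i x y, C x -> C y -> F i (x - y) = F i x - F i y,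
      forall x, C x -> finite_set [set i | F i x <> 0] &
      forall B, subgroup_set B -> I `<=` B -> C `<=` B].
Proof.
have [G [GP Gmax]] := Zorn_bigcup good_chain.
have [GB Gu GC Gd] := GP.
have G0 : G 0.
  apply: contrapT => nG0.
  have Gnil p : ~ G p by move=> Gp; apply: nG0; rewrite -[0](subrr p); exact: GB.
  apply: (Gmax [set 0]).
    by split=> [p /Gnil//|/(_ 0 erefl)].
  split=> [p q -> ->|u [->//]|p ->|B [B0 _] _ p -> //]; first by rewrite subrr.
  split=> //=; first by have [] := CP.
  by rewrite (_ : [set _ | _] = set0) //; apply/seteqP; split.
have domG x : C x -> exists u, G (x, u).
  move=> Cx; apply: contrapT => xG.
  have [v [vx finv sv xv]] := ex_extension_value GP G0 Cx xG.
  apply: Gmax (good_extension GP G0 Cx vx finv sv xv); split.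
    by move=> p Gp; exists p => //; exists 0; rewrite mulr0z addr0.
  move=> /(_ (x, v)) GG; apply: xG; exists v; apply: GG.
  by exists 0 => //; exists 1; rewrite add0r.
have /choice[F FP] x : exists u, C x -> G (x, u).
  have [/domG[u Gxu]|nCx] := pselect (C x); first by exists u.
  by exists 0 => /nCx.
exists (diag G), (fun i x => F x i).
have uniq x u : C x -> G (x, u) -> F x = u.
  move=> /FP GxF Gxu; apply/eqP; rewrite -subr_eq0; apply/eqP/Gu.
  suff -> : (0, F x - u) = (x, F x) - (x, u) by exact: GB.
  by congr (_, _); rewrite /= subrr.
have dC i : diag G i -> C i by move=> [u /GC[]].
split=> //.
- by move=> i di; have [u Giu] := di; rewrite (uniq i u) //; exact: dC.
- move=> i x y Cx Cy; rewrite (uniq (x - y) (F x - F y)) //.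
    by have [_] := CP; exact.
  by apply: (GB (x, F x) (y, F y)); exact: FP.
- by move=> x Cx; have [] := GC _ (FP _ Cx).
- by move=> B BP dB x /FP; exact: (Gd B BP dB (x, F x)).
Qed.

End spread_homs.

(** * The mean of a continuous function on a compact group *)

(** Finite sequences of indices, ordered by inclusion, form a filter, along
    which a near covering is a finite subcover. *)
Lemma compact_seq_cover (T : topologicalType) (I : eqType) (A : set T)
    (f : I -> set T) : compact A ->
  (forall x, A x -> exists i, nbhs x (f i)) ->
  exists s : seq I, forall x, A x -> exists2 i, i \in s & f i x.
Proof.
move=> /compact_near_coveringP ncA Af.
pose F : set_system (seq I) :=
  filter_from [set: seq I] (fun s => [set t : seq I | {subset s <= t}]).
have FF : Filter F.
  apply: filter_from_filter; first by exists [::].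
  move=> s t _ _; exists (s ++ t) => // r str.
  by split=> i ir; apply: str; rewrite mem_cat ir ?orbT.
have [x Ax|s _ sA] := ncA _ F (fun s x => exists2 i, i \in s & f i x) FF; last first.
  by exists s => x; apply: sA.
have [i xi] := Af _ Ax.
exists (f i, [set s : seq I | i \in s]) => /=; last by move=> [y s] /= [fy si]; exists i.
by split=> //; exists [:: i] => // s; apply; rewrite inE.
Qed.

Section topological_group.
Variable N : topologicalZmodType.

Lemma continuous_addr (a : N) : continuous (fun x => x + a).
Proof.
move=> x; apply: (@continuous_comp _ _ _ (fun x => (x, a)) (fun p => p.1 + p.2)).
  by apply: cvg_pair; [exact: cvg_id|exact: cvg_cst].
exact: add_continuous.
Qed.

Lemma nbhs_addr (a x : N) (V : set N) :
  nbhs (x + a) V -> nbhs x ((fun y => y + a) @^-1` V).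
Proof. exact: continuous_addr. Qed.

Lemma nbhs_sub0 (V : set N) : nbhs 0 V ->
  exists2 W : set N, nbhs 0 W & forall x y, W x -> W y -> V (x - y).
Proof.
move=> V0; have : nbhs ((0, 0) : N * N) ((fun p => p.1 - p.2) @^-1` V).
  by apply: sub_continuous; rewrite /= subrr.
move=> [[A B] /= [A0 B0] ABV]; exists (A `&` B); first exact: filterI.
by move=> x y [Ax _] [_ By]; exact: (ABV (x, y)).
Qed.

End topological_group.

Section compact_group.
Variables (R : realType) (N : topologicalZmodType).
Hypothesis cptN : compact [set: N].
Implicit Types (f g : N -> R) (s t : seq N) (V : set N).

Lemma compact_uniform_continuous f (e : R) : continuous f -> 0 < e ->
  exists2 V : set N, nbhs 0 V & forall x v, V v -> `|f (x + v) - f x| <= e.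
Proof.
move=> fc e0; have e20 : 0 < e / 2 by rewrite divr_gt0.
have /compact_near_coveringP ncN := cptN.
have := ncN N (nbhs (0 : N)) (fun v x => `|f (x + v) - f x| <= e) _.
move=> /(_ (nbhs_filter 0)) H; exists [set v | forall x, `|f (x + v) - f x| <= e].
  apply: filterS (H _) => [v vP x|x _]; first exact: vP.
  have fx : nbhs x (f @^-1` ball (f x) (e / 2)) by apply: fc; exact: nbhsx_ballx.
  have : nbhs ((x, 0) : N * N) ((fun p => p.1 + p.2) @^-1` (f @^-1` ball (f x) (e / 2))).
    by apply: add_continuous; rewrite /= addr0.
  move=> [[A B] /= [Ax B0] AB].
  exists (A `&` f @^-1` ball (f x) (e / 2), B) => /=; first by split=> //; exact: filterI.
  move=> [y v] /= [[Ay fy] Bv]; have /= := AB (y, v) (conj Ay Bv).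
  move: fy; rewrite /ball /= => fy fyv.
  rewrite (splitr e); apply: le_trans (lerD (ltW fyv) (ltW fy)).
  by rewrite (distrC (f x) (f (y + v))); exact: ler_distD.
by move=> x v; exact.
Qed.

Lemma compact_translates V : nbhs 0 V ->
  exists2 s : seq N, (0 < size s)%N & forall w, exists2 a, a \in s & V (w + a).
Proof.
move=> V0.
have [w _|s sP] := compact_seq_cover (f := fun a => (fun w => w + a) @^-1` V) cptN.
  by exists (- w); apply: nbhs_addr; rewrite subrr.
exists s => [|w]; last exact: sP.
by have [a] := sP 0 I; case: (s).
Qed.

Definition translate_mean s f x : R := (size s)%:R^-1 * \sum_(a <- s) f (x + a).

Lemma translate_meanD s f g x :
  translate_mean s (f \+ g) x = translate_mean s f x + translate_mean s g x.
Proof. by rewrite /translate_mean big_split mulrDr. Qed.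

Lemma translate_meanZ s (k : R) f x :
  translate_mean s (fun y => k * f y) x = k * translate_mean s f x.
Proof. by rewrite /translate_mean -mulr_sumr mulrCA. Qed.

Lemma translate_mean_le s f g : (0 < size s)%N -> (forall x, f x <= g x) ->
  forall x, translate_mean s f x <= translate_mean s g x.
Proof.
move=> s0 fg x; rewrite ler_wpM2l ?invr_ge0 ?ler0n //.
by apply: ler_sum => a _; exact: fg.
Qed.

Lemma translate_mean_cst s (k : R) x : (0 < size s)%N ->
  translate_mean s (fun=> k) x = k.
Proof.
move=> s0; rewrite /translate_mean big_const_seq count_predT iter_addr_0.
by rewrite -[k *+ _]mulr_natl mulKf // pnatr_eq0 -lt0n.
Qed.

Lemma translate_mean_dist s f (k e : R) : (0 < size s)%N ->
  (forall x, `|f x - k| <= e) -> forall x, `|translate_mean s f x - k| <= e.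
Proof.
move=> s0 fk x; rewrite ler_distl -{1}(translate_mean_cst (k - e) x s0).
rewrite -(translate_mean_cst (k + e) x s0).
by rewrite !translate_mean_le // => y; have := fk y; rewrite ler_distl => /andP[].
Qed.

Definition convolve_seq s t := [seq a + b | a <- s, b <- t].

Lemma size_convolve_seq s t : size (convolve_seq s t) = (size s * size t)%N.
Proof. exact: size_allpairs. Qed.

Lemma translate_mean_convolve s t f x :
  translate_mean (convolve_seq s t) f x =
  translate_mean s (translate_mean t f) x.
Proof.
rewrite /translate_mean size_convolve_seq big_allpairs_dep natrM invfM -mulrA.
congr (_ * _); rewrite mulr_sumr; apply: eq_bigr => a _; congr (_ * _).
by apply: eq_bigr => b _; rewrite addrA.
Qed.

Lemma translate_meanC s t f x :
  translate_mean s (translate_mean t f) x =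
  translate_mean t (translate_mean s f) x.
Proof.
rewrite -!translate_mean_convolve /translate_mean !size_convolve_seq mulnC.
congr (_ * _); rewrite !big_allpairs_dep exchange_big /=.
by apply: eq_bigr => b _; apply: eq_bigr => a _; rewrite [a + b]addrC.
Qed.

(** The constant [c] is a uniform limit of averages of translates of [f].  Two
    averages commute, so that there is at most one such [c]. *)
Definition mean_value f (c : R) := forall e, 0 < e ->
  exists2 s, (0 < size s)%N & forall x, `|translate_mean s f x - c| <= e.

Lemma mean_value_uniq f c d : mean_value f c -> mean_value f d -> c = d.
Proof.
move=> fc fd; apply/eqP; rewrite -subr_eq0 -normr_le0; apply/ler_addgt0Pl => e e0.
have e20 : 0 < e / 2 by rewrite divr_gt0.
have [s s0 sc] := fc _ e20; have [t t0 td] := fd _ e20.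
have := translate_mean_dist t0 sc 0; have := translate_mean_dist s0 td 0.
rewrite translate_meanC addr0 => h1; rewrite distrC => h2.
by rewrite (splitr e); apply: le_trans (lerD h2 h1); exact: ler_distD.
Qed.

Lemma mean_valueD f g c d :
  mean_value f c -> mean_value g d -> mean_value (f \+ g) (c + d).
Proof.
move=> fc gd e e0; have e20 : 0 < e / 2 by rewrite divr_gt0.
have [s s0 sc] := fc _ e20; have [t t0 td] := gd _ e20.
exists (convolve_seq s t); first by rewrite size_convolve_seq muln_gt0 s0.
move=> x; rewrite translate_meanD opprD addrACA (splitr e).
apply: le_trans (ler_normD _ _) (lerD _ _); rewrite translate_mean_convolve.
  by rewrite translate_meanC; exact: translate_mean_dist.
exact: translate_mean_dist.
Qed.

Lemma mean_valueZ (k : R) f c : mean_value f c -> mean_value (fun x => k * f x) (k * c).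
Proof.
move=> fc e e0; have k0 : 0 < `|k| + 1 by rewrite ltr_wpDl.
have [s s0 sc] := fc _ (divr_gt0 e0 k0); exists s => // x.
rewrite translate_meanZ -mulrBr normrM.
apply: le_trans (ler_wpM2l (normr_ge0 k) (sc x)) _.
by rewrite mulrCA ger_pMr // ler_pdivrMr // mul1r lerDl.
Qed.

Lemma mean_value_cst (k : R) : mean_value (fun=> k) k.
Proof.
move=> e e0; exists [:: 0] => // x.
by rewrite translate_mean_cst // subrr normr0 ltW.
Qed.

Lemma mean_value_ge0 f c : (forall x, 0 <= f x) -> mean_value f c -> 0 <= c.
Proof.
move=> f0 fc; apply/ler_addgt0Pl => e /fc[s s0 /(_ 0)].
rewrite ler_distl => /andP[_].
have := translate_mean_le s0 f0 0; rewrite translate_mean_cst //; lra.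
Qed.

Lemma mean_value_translate f c a :
  mean_value f c -> mean_value (fun x => f (x + a)) c.
Proof.
move=> fc e /fc[s s0 sc]; exists s => // x.
rewrite (_ : translate_mean _ _ _ = translate_mean s f (x + a)) //.
by congr (_ * _); apply: eq_bigr => b _; rewrite addrAC.
Qed.

(** Let [n] translates of a neighbourhood [V] cover the group, where [f] varies
    by at most [e / 4] along [V].  Among the [n] terms of the corresponding
    average of [f] at [x], one is within [e / 4] of the value at a fixed point:
    the oscillation is multiplied by at most [1 - 1 / n], up to the error
    [e / 2 / n].  As averages vary along [V] no more than [f] does, this can be
    iterated with the same translates, until the oscillation is at most [e]. *)
Lemma ex_mean_value f : continuous f -> exists c, mean_value f c.
Proof.
move=> fc; have small e : 0 < e -> exists s l u, [/\ (0 < size s)%N,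
    forall x, l <= translate_mean s f x <= u & u - l <= e].
  move=> e0; have e40 : 0 < e / 4 by rewrite divr_gt0.
  have [V V0 Vf] := compact_uniform_continuous fc e40.
  have [s s0 sV] := compact_translates V0.
  pose n : R := (size s)%:R; have n0 : 0 < n by rewrite ltr0n.
  have step g l u : (forall x v, V v -> `|g (x + v) - g x| <= e / 4) ->
      (forall x, l <= g x <= u) -> exists l' u',
      (forall x, l' <= translate_mean s g x <= u') /\
      u' - l' = (1 - n^-1) * (u - l) + n^-1 * (e / 2).
    move=> gV glu; exists (n^-1 * (g 0 - e / 4) + (1 - n^-1) * l).
    exists (n^-1 * (g 0 + e / 4) + (1 - n^-1) * u); split; last first.
      by rewrite [e](splitr e); lra.
    move=> x; have [a as_ Vxa] := sV x.
    have := gV 0 _ Vxa; rewrite add0r ler_distl => /andP[ga ga'].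
    have nE : n = (size (rem a s)).+1%:R.
      by rewrite size_rem // prednK.
    rewrite /translate_mean (perm_big _ (perm_to_rem as_)) big_cons /=.
    have sumE (k : R) : \sum_(b <- rem a s) k = (n - 1) * k.
      rewrite big_const_seq count_predT iter_addr_0 nE -[k *+ _]mulr_natl.
      by rewrite -natr1 addrK.
    have k1 k : (1 - n^-1) * k = n^-1 * ((n - 1) * k).
      by rewrite mulrA mulrBr mulVf ?mulr1 // gt_eqF.
    rewrite !k1 -!mulrDr !ler_pM2l ?invr_gt0 // -!sumE.
    by rewrite !lerD // ler_sum // => b _; have /andP[] := glu (x + b).
  have [C C0 fC] : exists2 C, 0 <= C & forall x, - C <= f x <= C.
    have [K [Kr fK]] := compact_bounded (continuous_compact (continuous_subspaceT fc) cptN).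
    exists (`|K| + 1) => [|x]; first by rewrite addr_ge0.
    by rewrite -ler_norml fK // (le_lt_trans (ler_norm K)) // ltrDl.
  have iterated k : exists t l u, [/\ (0 < size t)%N,
      forall x v, V v -> `|translate_mean t f (x + v) - translate_mean t f x| <= e / 4,
      forall x, l <= translate_mean t f x <= u &
      u - l <= (1 - n^-1) ^+ k * (C + C) + e / 2].
    elim: k => [|k [t [l [u [t0 tV tlu ul]]]]].
      have t1 x : translate_mean [:: 0] f x = f x.
        by rewrite /translate_mean big_seq1 addr0 invr1 mul1r.
      exists [:: 0], (- C), C; split=> // [x v Vv|x|]; rewrite ?t1 //; first exact: Vf.
      by rewrite expr0 mul1r opprK lerDl; lra.
    have [l' [u' [lu' ul']]] := step _ _ _ tV tlu.
    exists (convolve_seq s t), l', u'; split.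
    - by rewrite size_convolve_seq muln_gt0 s0.
    - move=> x v Vv; rewrite !translate_mean_convolve.
      rewrite -[translate_mean s _ (x + v) - _]subr0.
      have -> : translate_mean s (translate_mean t f) (x + v) -
          translate_mean s (translate_mean t f) x =
          translate_mean s (fun y => translate_mean t f (y + v) - translate_mean t f y) x.
        rewrite [in RHS]/translate_mean sumrB mulrBr; congr (_ * _ - _).
        by apply: eq_bigr => b _; rewrite addrAC.
      by apply: translate_mean_dist => // y; rewrite subr0; exact: tV.
    - by move=> x; rewrite translate_mean_convolve.
    - have n1 : 0 <= 1 - n^-1 by rewrite subr_ge0 invf_le1 // ler1n.
      have := ler_wpM2l n1 ul; rewrite ul' exprS -mulrA; nra.
  have q0 : 0 <= 1 - n^-1 by rewrite subr_ge0 invf_le1 // ler1n.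
  have q1 : `|1 - n^-1| < 1 by rewrite ger0_norm // gtrDl oppr_lt0 invr_gt0.
  have : (fun k => (1 - n^-1) ^+ k * (C + C)) @ \oo --> 0 * (C + C).
    by apply: cvgMl; exact: cvg_expr.
  rewrite mul0r => /cvgr0_norm_le /(_ (e / 2)) []; first by rewrite divr_gt0.
  move=> k _ /(_ k (leqnn k)) /= qk.
  have [t [l [u [t0 _ tlu ul]]]] := iterated k; exists t, l, u; split=> //.
  apply: le_trans ul _; rewrite [leRHS](splitr e) lerD2r.
  exact: le_trans (ler_norm _) qk.
(* The lower bounds of averages are below the upper bounds of averages, again
   because averages commute, and their supremum is the mean. *)
pose L := [set l | exists2 s, (0 < size s)%N & forall x, l <= translate_mean s f x].
have Lu s u l : (0 < size s)%N -> (forall x, translate_mean s f x <= u) -> L l -> l <= u.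
  move=> s0 su [t t0 tl]; have := translate_mean_le s0 tl 0.
  rewrite translate_mean_cst // translate_meanC => /le_trans; apply.
  by rewrite -[leRHS](translate_mean_cst u 0 t0); exact: translate_mean_le.
have [s1 [l1 [u1 [s10 s1lu _]]]] := small _ ltr01.
have supL : has_sup L.
  split; first by exists l1, s1 => // x; have /andP[] := s1lu x.
  by exists u1 => l; apply: Lu s10 _ => x; have /andP[] := s1lu x.
exists (sup L) => e /small[s [l [u [s0 slu ul]]]]; exists s => // x.
have /andP[lx xu] := slu x.
have lL : l <= sup L.
  by apply: sup_upper_bound => //; exists s => // y; have /andP[] := slu y.
have Lu' : sup L <= u.
  apply: ge_sup; first by case: supL.
  by move=> y; apply: Lu s0 _ => z; have /andP[] := slu z.
by rewrite ler_distl; apply/andP; split; lra.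
Qed.

End compact_group.

(** * Autocorrelation and convolution *)

Section real_continuity.
Variables (R : realType) (T : topologicalType).
Implicit Types f g : T -> R.

Lemma continuous_add f g : continuous f -> continuous g ->
  continuous (fun x => f x + g x).
Proof. by move=> fc gc x; apply: cvgD; [exact: fc|exact: gc]. Qed.

Lemma continuous_sub f g : continuous f -> continuous g ->
  continuous (fun x => f x - g x).
Proof. by move=> fc gc x; apply: cvgB; [exact: fc|exact: gc]. Qed.

Lemma continuous_mul f g : continuous f -> continuous g ->
  continuous (fun x => f x * g x).
Proof. by move=> fc gc x; apply: cvgM; [exact: fc|exact: gc]. Qed.

Lemma continuous_scale (k : R) f : continuous f -> continuous (fun x => k * f x).
Proof. by move=> fc; apply: continuous_mul => //; exact: cst_continuous. Qed.

Lemma continuous_bounded f : compact [set: T] -> continuous f ->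
  exists2 C, 0 < C & forall x, `|f x| <= C.
Proof.
move=> cptT fc.
have [K [Kr fK]] := compact_bounded (continuous_compact (continuous_subspaceT fc) cptT).
exists (`|K| + 1) => [|x]; first by rewrite ltr_wpDl.
by rewrite fK // (le_lt_trans (ler_norm K)) // ltrDl.
Qed.

Lemma bump_function (x : T) (W : set T) : compact [set: T] -> hausdorff_space T ->
  nbhs x W -> exists f, [/\ continuous f, forall y, 0 <= f y, f x = 1 &
    forall y, f y != 0 -> W y].
Proof.
move=> cptT hT xW; have clx : closed [set x].
  by apply: accessible_closed_set1; exact: hausdorff_accessible.
have clW : closed (~` W°) by apply: open_closedC; exact: open_interior.
have /(@normal_separatorP R) nT := compact_normal hT cptT.
have [|f [fc f01 f0 f1]] := (@uniform_separatorP T R _ _).1 (nT _ _ clx clW _).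
  by apply/seteqP; split=> // y [/= ->]; apply.
exists (fun y => 1 - f y); split.
- by apply: continuous_sub => //; exact: cst_continuous.
- move=> y; rewrite subr_ge0; have : range f (f y) by exists y.
  by move=> /f01 /=; rewrite in_itv /= => /andP[].
- by rewrite (_ : f x = 0) ?subr0 //; apply: f0; exists x.
- move=> y fy; apply: contrapT => Wy; move/eqP: fy; apply.
  rewrite (_ : f y = 1) ?subrr //; apply: f1; exists y => // /interior_subset.
  exact: Wy.
Qed.

End real_continuity.

Section haar_mean.
Variables (R : realType) (N : topologicalZmodType).
Hypothesis cptN : compact [set: N].
Implicit Types (f g h : N -> R) (V : set N).

Definition haar_mean f : R := xget 0 (mean_value f).

Local Notation M := haar_mean.

Lemma haar_meanE f c : mean_value f c -> M f = c.
Proof.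
by move=> fc; rewrite /M; case: xgetP => [d _ fd|/(_ c)//]; exact: mean_value_uniq fd fc.
Qed.

Lemma haar_meanP f : continuous f -> mean_value f (M f).
Proof. by move=> /(ex_mean_value cptN)[c fc]; rewrite (haar_meanE fc). Qed.

Lemma haar_meanD f g : continuous f -> continuous g ->
  M (fun x => f x + g x) = M f + M g.
Proof. by move=> fc gc; apply/haar_meanE/mean_valueD; exact: haar_meanP. Qed.

Lemma haar_meanZ (k : R) f : continuous f -> M (fun x => k * f x) = k * M f.
Proof. by move=> fc; apply/haar_meanE/mean_valueZ; exact: haar_meanP. Qed.

Lemma haar_meanB f g : continuous f -> continuous g ->
  M (fun x => f x - g x) = M f - M g.
Proof.
move=> fc gc; rewrite -[M g]mul1r -mulNr -haar_meanZ // -haar_meanD //.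
  by congr M; apply/funext => x; rewrite mulN1r.
exact: continuous_scale.
Qed.

Lemma haar_mean_cst (k : R) : M (fun=> k) = k.
Proof. exact/haar_meanE/mean_value_cst. Qed.

Lemma haar_mean_ge0 f : continuous f -> (forall x, 0 <= f x) -> 0 <= M f.
Proof. by move=> fc f0; exact: mean_value_ge0 f0 (haar_meanP fc). Qed.

Lemma haar_mean_le f g : continuous f -> continuous g ->
  (forall x, f x <= g x) -> M f <= M g.
Proof.
move=> fc gc fg; rewrite -subr_ge0 -haar_meanB //.
by apply: haar_mean_ge0 => [|x]; [exact: continuous_sub|rewrite subr_ge0].
Qed.

Lemma haar_mean_norm f (e : R) : continuous f -> (forall x, `|f x| <= e) -> `|M f| <= e.
Proof.
move=> fc fe; rewrite ler_norml -{1}(haar_mean_cst (- e)) -{2}(haar_mean_cst e).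
have ce (k : R) : continuous (fun _ : N => k) by exact: cst_continuous.
by rewrite !haar_mean_le // => x; have := fe x; rewrite ler_norml => /andP[].
Qed.

Lemma haar_mean_translate f a : continuous f -> M (fun x => f (x + a)) = M f.
Proof. by move=> fc; apply/haar_meanE/mean_value_translate; exact: haar_meanP. Qed.

Lemma continuous_translate f a : continuous f -> continuous (fun x => f (x + a)).
Proof.
by move=> fc x; apply: (@continuous_comp _ _ _ (fun x => x + a) f);
  [exact: continuous_addr|exact: fc].
Qed.

Lemma continuous_reflect f a : continuous f -> continuous (fun x => f (a - x)).
Proof.
move=> fc x; apply: (@continuous_comp _ _ _ (fun x => a - x) f); last exact: fc.
apply: (@continuous_comp _ _ _ (fun x => (a, x)) (fun p => p.1 - p.2)).
  by apply: cvg_pair; [exact: cvg_cst|exact: cvg_id].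
exact: sub_continuous.
Qed.

(** The constant [d] is the inverse of a number of translates of [V] that cover
    the group: the average of [f] over them is at least [d * c] everywhere. *)
Lemma haar_mean_lower V : nbhs 0 V -> exists2 d : R, 0 < d &
  forall f x c, continuous f -> (forall y, 0 <= f y) ->
    (forall v, V v -> c <= f (x + v)) -> d * c <= M f.
Proof.
move=> /(compact_translates cptN)[s s0 sV].
exists (size s)%:R^-1; first by rewrite invr_gt0 ltr0n.
move=> f x c fc f0 fV; have [c0|c0] := ltP c 0.
  apply: le_trans (haar_mean_ge0 fc f0).
  by rewrite pmulr_rle0 ?ltW // invr_gt0 ltr0n.
apply/ler_addgt0Pl => e e0; have [t t0 tc] := haar_meanP fc e0.
have := translate_mean_dist s0 tc 0; rewrite translate_meanC ler_distl => /andP[_].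
rewrite addrC => tsM; apply: le_trans tsM.
rewrite -{1}(translate_mean_cst ((size s)%:R^-1 * c) 0 t0).
apply: translate_mean_le => // y; rewrite /translate_mean.
rewrite ler_pM2l ?invr_gt0 ?ltr0n //.
have [a as_ Vya] := sV (y - x); rewrite (perm_big _ (perm_to_rem as_)) big_cons /=.
rewrite -[c]addr0 lerD ?sumr_ge0 //.
by have := fV _ Vya; rewrite addrA [x + _]addrC subrK.
Qed.

Lemma haar_mean_gt0 f x : continuous f -> (forall y, 0 <= f y) -> f x != 0 -> 0 < M f.
Proof.
move=> fc f0 fx; have fx0 : 0 < f x by rewrite lt_neqAle eq_sym fx f0.
have [V V0 fV] := compact_uniform_continuous cptN fc (divr_gt0 fx0 (ltr0n _ 2)).
have [d d0 dM] := haar_mean_lower V0; apply: lt_le_trans (dM f x (f x / 2) fc f0 _).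
  by rewrite mulr_gt0 // divr_gt0.
by move=> v /(fV x); rewrite ler_distl => /andP[+ _]; lra.
Qed.

Lemma continuous_of_modulus f : (forall e : R, 0 < e ->
    exists2 V, nbhs 0 V & forall x v, V v -> `|f (x + v) - f x| <= e) ->
  continuous f.
Proof.
move=> fV x; apply/cvgrPdistC_le => e /fV[V V0 Vf]; near=> y.
rewrite -[y](subrK x) [y - x + x]addrC; apply: Vf; near: y.
by apply: nbhs_addr; rewrite subrr.
Unshelve. all: by end_near. Qed.

(** A positive-definite function, whose value at 0 is the squared norm of [f]. *)
Definition autocorrelation f (z : N) : R := M (fun y => f (y + z) * f y).

Definition convolution h f (x : N) : R := M (fun z => h (x - z) * f z).

Section autocorrelation.
Variable f : N -> R.
Hypothesis fc : continuous f.

Let ffc z : continuous (fun y => f (y + z) * f y).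
Proof. by apply: continuous_mul => //; exact: continuous_translate. Qed.

Lemma continuous_autocorrelation : continuous (autocorrelation f).
Proof.
have [C C0 fC] := continuous_bounded cptN fc.
apply: continuous_of_modulus => e e0.
have [V V0 Vf] := compact_uniform_continuous cptN fc (divr_gt0 e0 C0).
exists V => // x v Vv; rewrite /autocorrelation -haar_meanB //.
apply: haar_mean_norm => [|y]; first exact: continuous_sub.
rewrite -mulrBl normrM -(divfK (lt0r_neq0 C0) e) ler_pM //.
by rewrite addrA; exact: Vf.
Qed.

Lemma autocorrelation0 : autocorrelation f 0 = M (fun y => f y ^+ 2).
Proof. by congr M; apply/funext => y; rewrite addr0. Qed.

Lemma autocorrelationN z : autocorrelation f (- z) = autocorrelation f z.
Proof.
rewrite /autocorrelation -(haar_mean_translate z) //; congr M.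
by apply/funext => y; rewrite addrK mulrC.
Qed.

Lemma autocorrelation_norm z : `|autocorrelation f z| <= autocorrelation f 0.
Proof.
have sqc : continuous (fun y => f y ^+ 2) by exact: continuous_mul.
have sqc' : continuous (fun y => f (y + z) ^+ 2) by exact: (continuous_translate sqc).
have E : M (fun y => 2^-1 * (f (y + z) ^+ 2 + f y ^+ 2)) = autocorrelation f 0.
  rewrite haar_meanZ; last exact: continuous_add.
  rewrite haar_meanD // (haar_mean_translate z sqc) autocorrelation0; lra.
have Ec : continuous (fun y => 2^-1 * (f (y + z) ^+ 2 + f y ^+ 2)).
  by apply: continuous_scale; exact: continuous_add.
rewrite ler_norml -E lerNl; apply/andP; split; last first.
  by apply: haar_mean_le => // y; have := sqr_ge0 (f (y + z) - f y); lra.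
rewrite -mulN1r -haar_meanZ //; apply: haar_mean_le => //.
  exact: continuous_scale.
by move=> y; have := sqr_ge0 (f (y + z) + f y); lra.
Qed.

Lemma autocorrelation_scale (k : R) z :
  autocorrelation (fun y => k * f y) z = k ^+ 2 * autocorrelation f z.
Proof.
rewrite /autocorrelation -haar_meanZ //; congr M; apply/funext => y.
by rewrite mulrACA.
Qed.

(** With [e] equal to 1 and to -1 the right-hand sides add up to 4 times the
    autocorrelation of [f], which they split into positive-definite functions. *)
Lemma autocorrelation_split (e : R) b z : e ^+ 2 = 1 ->
  autocorrelation (fun y => f y + e * f (y + b)) z =
  2 * autocorrelation f z +
  e * (autocorrelation f (z + b) + autocorrelation f (z - b)).
Proof.
move=> e1; have fb := continuous_translate (a := b) fc.
have fzb : continuous (fun y => f (y + (z + b))) by exact: continuous_translate.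
have fz : continuous (fun y => f (y + z)) by exact: continuous_translate.
have c1 : continuous (fun y => f (y + b + z) * f (y + b)).
  by apply: continuous_mul => //; apply: (continuous_translate (f := fun y => f (y + z))).
have c2 : continuous (fun y => f (y + (z + b)) * f y) by exact: ffc.
have c3 : continuous (fun y => f (y + z) * f (y + b)) by exact: continuous_mul.
have -> : autocorrelation f (z - b) = M (fun y => f (y + z) * f (y + b)).
  rewrite /autocorrelation -(haar_mean_translate b (@ffc (z - b))); congr M.
  by apply/funext => y; rewrite addrA addrAC addrK.
have -> : 2 * autocorrelation f z = autocorrelation f z +
    M (fun y => f (y + b + z) * f (y + b)).
  by rewrite (haar_mean_translate b (@ffc z)) mulr_natl mulr2n.
rewrite /autocorrelation -!haar_meanD // -haar_meanZ; last exact: continuous_add.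
rewrite -haar_meanD; last 2 first.
- exact: continuous_add.
- by apply: continuous_scale; exact: continuous_add.
congr M; apply/funext => y; rewrite [y + b + z]addrAC [y + (z + b)]addrA.
have -> : f (y + z + b) * f (y + b) = e ^+ 2 * (f (y + z + b) * f (y + b)).
  by rewrite e1 mul1r.
ring.
Qed.

End autocorrelation.

Section convolution.
Variable h : N -> R.
Hypothesis hc : continuous h.

Let hfc f x : continuous f -> continuous (fun z => h (x - z) * f z).
Proof. by move=> fc; apply: continuous_mul => //; exact: continuous_reflect. Qed.

(** The modulus of continuity depends on [h] alone.  The bound 1 holds for the
    autocorrelation of a function of norm 1. *)
Lemma convolution_modulus f (e : R) V : continuous f ->
  (forall x v, V v -> `|h (x + v) - h x| <= e) -> (forall z, `|f z| <= 1) ->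
  forall x v, V v -> `|convolution h f (x + v) - convolution h f x| <= e.
Proof.
move=> fc hV f1 x v Vv; rewrite /convolution -haar_meanB; try exact: hfc.
apply: haar_mean_norm => [|z]; first by apply: continuous_sub; exact: hfc.
rewrite -mulrBl normrM -[e]mulr1 ler_pM // addrAC; exact: hV.
Qed.

Lemma convolution_norm f (C : R) : continuous f -> (forall x, `|h x| <= C) ->
  (forall z, `|f z| <= 1) -> forall x, `|convolution h f x| <= C.
Proof.
move=> fc hC f1 x; apply: haar_mean_norm => [|z]; first exact: hfc.
by rewrite normrM -[C]mulr1 ler_pM.
Qed.

Lemma convolutionD f g x : continuous f -> continuous g ->
  convolution h (fun z => f z + g z) x = convolution h f x + convolution h g x.
Proof.
move=> fc gc; rewrite /convolution -haar_meanD; try exact: hfc.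
by congr M; apply/funext => z; rewrite mulrDr.
Qed.

Lemma convolutionZ (k : R) f x : continuous f ->
  convolution h (fun z => k * f z) x = k * convolution h f x.
Proof.
move=> fc; rewrite /convolution -haar_meanZ; last exact: hfc.
by congr M; apply/funext => z; rewrite mulrCA.
Qed.

Lemma convolution_translate f b x : continuous f ->
  convolution h (fun z => f (z + b)) x = convolution h f (x + b).
Proof.
move=> fc; rewrite /convolution -(haar_mean_translate b (hfc (x := x + b) fc)).
by congr M; apply/funext => z; rewrite opprD addrACA subrr addr0.
Qed.

End convolution.

End haar_mean.

(** * Functions of maximal energy *)

Section extremal.
Variables (R : realType) (N : topologicalZmodType).
Hypothesis cptN : compact [set: N].
Variable h : N -> R.
Hypothesis hc : continuous h.

Local Notation M := (@haar_mean R N).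
Local Notation eta f := (convolution h (autocorrelation f)).

Definition energy (f : N -> R) : R := M (fun x => eta f x ^+ 2).

Definition normalized (f : N -> R) := continuous f /\ autocorrelation f 0 = 1.

Lemma normalized_norm f z : normalized f -> `|autocorrelation f z| <= 1.
Proof. by move=> [fc <-]; exact: autocorrelation_norm. Qed.

Lemma continuous_convolution g : continuous g -> (forall z, `|g z| <= 1) ->
  continuous (convolution h g).
Proof.
move=> gc g1; apply: continuous_of_modulus => e /(compact_uniform_continuous cptN hc).
by move=> [V V0 hV]; exists V => //; exact: convolution_modulus.
Qed.

Definition energy_sup : R := sup [set energy f | f in normalized].

Lemma energy_has_ubound : has_ubound [set energy f | f in normalized].
Proof.
have [C C0 hC] := continuous_bounded cptN hc.
exists (C ^+ 2) => _ [g gn <-]; have g1 z := normalized_norm z gn.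
have gcc : continuous (autocorrelation g).
  by case: gn => gc _; exact: continuous_autocorrelation.
rewrite /energy -(@haar_mean_cst R N (C ^+ 2)); apply: haar_mean_le => //.
- by apply: continuous_mul; exact: continuous_convolution.
- exact: cst_continuous.
- move=> x; rewrite -[X in X <= _]real_normK ?num_real //.
  rewrite ler_sqr ?nnegrE ?(ltW C0) //.
  exact: (convolution_norm cptN hc gcc hC g1).
Qed.

Lemma energy_sup_ub f : normalized f -> energy f <= energy_sup.
Proof. by move=> fn; apply: ub_le_sup; [exact: energy_has_ubound|exists f]. Qed.

Lemma continuous_eta f : continuous f -> continuous (eta f).
Proof.
move=> fc; have [C C0 fC] := continuous_bounded cptN (continuous_autocorrelation cptN fc).
have fcc := continuous_autocorrelation cptN fc.
have -> : eta f = fun x => C * convolution h (fun z => C^-1 * autocorrelation f z) x.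
  apply/funext => x; rewrite convolutionZ // mulrA divff ?mul1r //.
  exact: lt0r_neq0.
apply: continuous_scale; apply: continuous_convolution.
  exact: continuous_scale.
by move=> z; rewrite normrM normfV (gtr0_norm C0) ler_pdivrMl // mulr1.
Qed.

(** The energy is homogeneous of degree 4 in [f], the autocorrelation of degree
    2. *)
Lemma energy_le f : continuous f -> energy f <= energy_sup * autocorrelation f 0 ^+ 2.
Proof.
move=> fc; have fcc := continuous_autocorrelation cptN fc.
have T0 : 0 <= autocorrelation f 0.
  exact: le_trans (normr_ge0 _) (autocorrelation_norm cptN fc 0).
have [Tz|Tnz] := eqVneq (autocorrelation f 0) 0.
  have -> : energy f = 0.
    rewrite /energy -[RHS](@haar_mean_cst R N); congr M; apply/funext => x.
    suff -> : eta f x = 0 by rewrite expr0n.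
    rewrite /convolution -[RHS](@haar_mean_cst R N); congr M; apply/funext => z.
    have := autocorrelation_norm cptN fc z; rewrite Tz normr_le0 => /eqP ->.
    by rewrite mulr0.
  by rewrite Tz expr0n mulr0.
pose k := (Num.sqrt (autocorrelation f 0))^-1.
have k2 : k ^+ 2 = (autocorrelation f 0)^-1 by rewrite exprVn sqr_sqrtr.
have kfn : normalized (fun y => k * f y).
  by split; [exact: continuous_scale|rewrite autocorrelation_scale // k2 mulVf].
have := energy_sup_ub kfn.
have -> : energy (fun y => k * f y) = (autocorrelation f 0)^-1 ^+ 2 * energy f.
  rewrite /energy -haar_meanZ //; last by apply: continuous_mul; exact: continuous_eta.
  congr M; apply/funext => x; rewrite -exprMn; congr (_ ^+ 2).
  rewrite -convolutionZ //; congr (convolution h _ x); apply/funext => z.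
  by rewrite autocorrelation_scale // k2.
rewrite exprVn => E; rewrite -ler_pdivrMr 1?mulrC //.
by rewrite exprn_gt0 // lt_neqAle eq_sym Tnz.
Qed.

Lemma eta_split (f : N -> R) (e : R) b x : continuous f -> e ^+ 2 = 1 ->
  eta (fun y => f y + e * f (y + b)) x =
  2 * eta f x + e * (eta f (x + b) + eta f (x - b)).
Proof.
move=> fc e1; have fcc := continuous_autocorrelation cptN fc.
have fb c := continuous_translate (a := c) fcc.
rewrite -!convolution_translate // -convolutionD // -!convolutionZ //; last first.
  exact: continuous_add.
rewrite -convolutionD //; last 2 first.
- exact: continuous_scale.
- by apply: continuous_scale; exact: continuous_add.
congr (convolution h _ x); apply/funext => z.
exact: autocorrelation_split.
Qed.

(** The failure of [eta f] to be an eigenvector of the symmetrized translation by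
    [b], with the eigenvalue suggested by the autocorrelation of [f]. *)
Definition defect f b x : R :=
  eta f (x + b) + eta f (x - b) - 2 * autocorrelation f b * eta f x.

Lemma continuous_defect f b : continuous f -> continuous (defect f b).
Proof.
move=> fc; have ec := continuous_eta fc; apply: continuous_sub.
  by apply: continuous_add; exact: continuous_translate.
exact: continuous_scale.
Qed.

(** Write [s] for the autocorrelation of [f] at [b], and [D] for the defect.  The
    two pieces [f + f(. + b)] and [f - f(. + b)] have squared norms [2 + 2 * s]
    and [2 - 2 * s], and their functions [eta] are [(2 + 2 * s) * eta f + D] and
    [(2 - 2 * s) * eta f - D].  The bound [energy_le] for both, with the weights
    that cancel the scalar product of [eta f] and [D], bounds the norm of [D]. *)
Lemma defect_le f b : normalized f ->
  M (fun x => defect f b x ^+ 2) <= 4 * (energy_sup - energy f).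
Proof.
move=> fn; have [fc f1] := fn; have ec := continuous_eta fc.
have dc := continuous_defect (b := b) fc.
set D := defect f b.
have [s sE] : exists s, s = autocorrelation f b by eexists.
have s1 : `|s| <= 1 by rewrite sE; exact: normalized_norm.
pose X := M (fun x => eta f x * D x); pose Y := M (fun x => D x ^+ 2).
have piece (e : R) : e ^+ 2 = 1 ->
    (2 + 2 * e * s) ^+ 2 * energy f + 2 * (2 + 2 * e * s) * e * X + Y <=
    energy_sup * (2 + 2 * e * s) ^+ 2.
  move=> e1; pose g y := f y + e * f (y + b).
  have gc : continuous g.
    by apply: continuous_add => //; apply: continuous_scale; exact: continuous_translate.
  have g0 : autocorrelation g 0 = 2 + 2 * e * s.
    rewrite autocorrelation_split // f1 add0r sub0r autocorrelationN // -sE; ring.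
  have := energy_le gc; rewrite g0; congr (_ <= _).
  have gE x : eta g x = (2 + 2 * e * s) * eta f x + e * D x.
    rewrite eta_split // /D /defect -sE; ring.
  have c1 : continuous (fun x => eta f x ^+ 2) by exact: continuous_mul.
  have c2 : continuous (fun x => eta f x * D x) by exact: continuous_mul.
  have c3 : continuous (fun x => D x ^+ 2) by exact: continuous_mul.
  rewrite /energy /X /Y -!haar_meanZ //.
  rewrite -!haar_meanD //; first last.
  - exact: continuous_scale.
  - exact: continuous_scale.
  - by apply: continuous_add; exact: continuous_scale.
  congr M; apply/funext => x; rewrite gE.
  have -> : D x ^+ 2 = e ^+ 2 * D x ^+ 2 by rewrite e1 mul1r.
  ring.
have H1 := piece 1 (expr1n _ 2).
have H2 := piece (- 1) (etrans (sqrrN 1) (expr1n _ 2)).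
have Jm := energy_sup_ub fn.
have [p0 q0] : 0 <= 1 + s /\ 0 <= 1 - s.
  by move: s1; rewrite ler_norml => /andP[]; lra.
have := ler_wpM2l q0 H1; have := ler_wpM2l p0 H2; rewrite -/Y.
move: (energy f) energy_sup Jm => J m Jm K1 K2.
have : Y <= 4 * ((1 + s) * (1 - s)) * (m - J) by lra.
have : 0 <= s ^+ 2 * (m - J) by rewrite mulr_ge0 ?sqr_ge0 // subr_ge0.
lra.
Qed.


(** With [f] concentrated near 0, [eta f x0] is close to a positive multiple of
    [h x0]. *)
Lemma energy_sup_gt0 x0 : hausdorff_space N -> h x0 != 0 -> 0 < energy_sup.
Proof.
move=> hN hx0; have hx0' : 0 < `|h x0| by rewrite normr_gt0.
have [V V0 hV] := compact_uniform_continuous cptN hc (divr_gt0 hx0' (ltr0n _ 2)).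
have [W W0 WV] := nbhs_sub0 V0.
have [f [fc f0 f1 fW]] := bump_function R cptN hN W0.
have fcc := continuous_autocorrelation cptN fc.
have ffc z : continuous (fun y => f (y + z) * f y).
  by apply: continuous_mul => //; exact: continuous_translate.
have psi0 z : 0 <= autocorrelation f z.
  by apply: haar_mean_ge0 => // y; exact: mulr_ge0.
have psiV z : autocorrelation f z != 0 -> V (- z).
  move=> /eqP pz; have [y fy] : exists y, f (y + z) * f y != 0.
    apply: contrapT => ny; apply: pz.
    rewrite /autocorrelation -[RHS](@haar_mean_cst R N); congr M; apply/funext => y.
    by apply/eqP; apply: contrapT => /negP fy; apply: ny; exists y.
  have [/fW Wyz /fW Wy] : f (y + z) != 0 /\ f y != 0.
    by move: fy; rewrite mulf_eq0 negb_or => /andP[].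
  by have := WV _ _ Wy Wyz; rewrite opprD addNKr.
have T0 : 0 < autocorrelation f 0.
  rewrite autocorrelation0; apply: (haar_mean_gt0 cptN (x := 0)) => [|y|].
  - exact: continuous_mul.
  - exact: sqr_ge0.
  - by rewrite f1 expr1n oner_neq0.
suff E0 : 0 < energy f.
  by have := lt_le_trans E0 (energy_le fc); rewrite pmulr_lgt0 // exprn_gt0.
have ec := continuous_eta fc.
apply: (haar_mean_gt0 cptN (x := x0)) => [|y|]; [exact: continuous_mul|exact: sqr_ge0|].
rewrite sqrf_eq0; suff : 0 < h x0 * eta f x0.
  by apply: contraTneq => ->; rewrite mulr0 ltxx.
have hfc : continuous (fun z => h (x0 - z) * autocorrelation f z).
  by apply: continuous_mul => //; exact: continuous_reflect.
rewrite /convolution -haar_meanZ //.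
have P0 : 0 < M (fun z => h x0 ^+ 2 / 2 * autocorrelation f z).
  apply: (haar_mean_gt0 cptN (x := 0)) => [|y|].
  - exact: continuous_scale.
  - by rewrite mulr_ge0 // divr_ge0 // sqr_ge0.
  - by rewrite !mulf_neq0 // ?sqrf_eq0 // lt0r_neq0.
apply: lt_le_trans P0 _; apply: haar_mean_le => // [||z].
- exact: continuous_scale.
- exact: continuous_scale.
- have [->|/psiV/(hV x0)] := eqVneq (autocorrelation f z) 0; first by rewrite !mulr0.
  rewrite mulrA => hxz; rewrite ler_wpM2r //.
  have : `|h x0 * (h (x0 - z) - h x0)| <= h x0 ^+ 2 / 2.
    rewrite normrM -[X in _ <= X / 2]real_normK ?num_real // expr2 -mulrA.
    by rewrite ler_wpM2l.
  by rewrite ler_norml => /andP[+ _]; lra.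
Qed.

Lemma eta_modulus f (e : R) (V : set N) : normalized f ->
  (forall x v, V v -> `|h (x + v) - h x| <= e) ->
  forall x v, V v -> `|eta f (x + v) - eta f x| <= e.
Proof.
move=> fn hV; have [fc _] := fn.
have fcc := continuous_autocorrelation cptN fc.
exact: (convolution_modulus cptN hc fcc hV (fun z => normalized_norm z fn)).
Qed.

Lemma defect_modulus f (e : R) (V : set N) b : normalized f ->
  (forall x v, V v -> `|h (x + v) - h x| <= e) ->
  forall x v, V v -> `|defect f b (x + v) - defect f b x| <= 4 * e.
Proof.
move=> fn hV x v Vv; have eV y := eta_modulus fn hV y Vv.
have s1 := normalized_norm b fn.
have := eV (x + b); have := eV (x - b); have := eV x.
rewrite /defect [x + v + b]addrAC [x + v - b]addrAC.
move: (eta f) (eta f (x + v)) => F A h1 h2 h3.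
have {}h1 : `|autocorrelation f b * (A - F x)| <= e.
  by rewrite normrM -[e]mul1r ler_pM.
move: h1 h2 h3; rewrite !ler_norml => /andP[? ?] /andP[? ?] /andP[? ?].
by apply/andP; split; lra.
Qed.

(** Along a maximizing sequence the defects tend to 0 in mean square, hence
    pointwise because they are equicontinuous. *)
Lemma defect_cvg0 (fs : nat -> N -> R) b x : (forall n, normalized (fs n)) ->
  (forall n, energy_sup - energy (fs n) <= n.+1%:R^-1) ->
  (fun n => defect (fs n) b x) @ \oo --> (0 : R).
Proof.
move=> fsn fsE.
suff small (e : R) : 0 < e -> \forall n \near \oo, `|defect (fs n) b x| <= e.
  by apply/cvgr0Pnorm_le => e; exact: small.
move=> e0; have e80 : 0 < e / 8 by rewrite divr_gt0.
have [V V0 hV] := compact_uniform_continuous cptN hc e80.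
have [d d0 dM] := haar_mean_lower R cptN V0.
pose c := d * (e / 2) ^+ 2 / 4.
have c0 : 0 < c by rewrite divr_gt0 // mulr_gt0 // exprn_gt0 // divr_gt0.
have : \forall n \near \oo, n.+1%:R^-1 < c :> R.
  exact: (near_infty_natSinv_lt (PosNum c0)).
apply: filterS => n nc; rewrite leNgt; apply/negP => en.
have [fc _] := fsn n; have dc := continuous_defect (b := b) fc.
have : d * (e / 2) ^+ 2 <= M (fun x => defect (fs n) b x ^+ 2).
  apply: (dM _ x) => [|y|v Vv]; [exact: continuous_mul|exact: sqr_ge0|].
  rewrite -[X in _ <= X]real_normK ?num_real // ler_sqr ?nnegrE ?divr_ge0 ?(ltW e0) //.
  have := defect_modulus b (fsn n) hV x Vv.
  have := lerB_dist (defect (fs n) b x) (defect (fs n) b (x + v)).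
  have : `|defect (fs n) b x| <=
      `|defect (fs n) b (x + v)| + `|defect (fs n) b (x + v) - defect (fs n) b x|.
    by rewrite -[X in `|X| <= _](subKr (defect (fs n) b (x + v))) ler_normB.
  by move: en; lra.
have := defect_le b (fsn n); have := le_lt_trans (fsE n) nc; rewrite /c.
move: (M _) (d * _) (energy _) energy_sup => A B C D; lra.
Qed.

End extremal.

Lemma ultra_bounded_cvg (R : realType) (U : set_system nat) (u : nat -> R) (C : R) :
  UltraFilter U -> (forall n, `|u n| <= C) -> exists l : R, u @ U --> l.
Proof.
move=> UU uC.
have UP : ProperFilter U by exact: ultra_proper.
have uCC : (u @ U) `[- C, C]%classic.
  apply: (@filterE _ U _ (u @^-1` `[- C, C]%classic)) => n /=.
  by rewrite in_itv /= -ler_norml; exact: uC.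
have [l [_ lcl]] := @segment_compact R (- C) C (u @ U) _ uCC.
exists l => A lA; have [//|UnA] := in_ultra_setVsetC (u @^-1` A) UU.
by have [y []] := lcl (~` A) A UnA lA.
Qed.

(** * Solutions of the cosine functional equation *)

Lemma cvg_norm_le (R : realType) (U : set_system nat) (u : nat -> R) (l e : R) :
  ProperFilter U -> u @ U --> l -> (forall n, `|u n| <= e) -> `|l| <= e.
Proof.
move=> UP ul ue; apply/ler_addgt0Pl => k k0.
have [n] : exists n, `|l - u n| < k.
  have Un : U [set n | `|l - u n| < k].
    by move: ul => /cvgrPdist_lt; apply.
  exact: filter_ex Un.
have := ue n; have : `|l| <= `|l - u n| + `|u n|.
  by rewrite -{1}(subrK (u n) l) ler_normD.
lra.
Qed.

Lemma filter_all_seq (T : eqType) (I : Type) (U : set_system I) (P : T -> I -> Prop)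
    (s : seq T) : Filter U ->
  (forall a, U [set i | P a i]) -> U [set i | forall a, a \in s -> P a i].
Proof.
move=> UF UP; elim: s => [|a s IHs]; first by apply: filterE.
apply: filterS2 (UP a) IHs => i ai si b; rewrite inE => /orP[/eqP ->//|].
exact: si.
Qed.

Lemma bounded_multiples_eq0 (R : realType) (d C : R) :
  (forall k, `|d *+ k| <= C) -> d = 0.
Proof.
move=> dC; apply/eqP; apply: contraT => d0.
have d0' : 0 < `|d| by rewrite normr_gt0.
have C0 : 0 <= C by have := dC 0%N; rewrite mulr0n normr0.
have := archi_boundP (divr_ge0 C0 (ltW d0')); rewrite ltr_pdivrMr //.
by rewrite ltNge mulr_natl -normrMn dC.
Qed.

Section dalembert.
Variables (R : realType) (N : topologicalZmodType).
Hypothesis cptN : compact [set: N].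
Hypothesis hN : hausdorff_space N.

Local Notation M := (@haar_mean R N).
Local Notation eta h f := (convolution h (autocorrelation f)).

(** The limits [F] of the functions [eta] and [s] of the autocorrelations along a
    maximizing sequence.  Were [F] zero, equicontinuity would make the functions
    [eta] uniformly small, against the value of their energies. *)
Lemma ex_extremal_limit (h : N -> R) x0 : continuous h -> h x0 != 0 ->
  exists (U : set_system nat) (fs : nat -> N -> R) (F s : N -> R),
  [/\ ProperFilter U /\ (forall n, normalized (fs n)),
      forall x, (fun n => eta h (fs n) x) @ U --> F x,
      continuous F /\ exists x, F x != 0,
      forall y, `|s y| <= 1 &
      forall x y, F (x + y) + F (x - y) = 2 * s y * F x].
Proof.
move=> hc hx0; have m0 := energy_sup_gt0 cptN hc hN hx0.
set m := energy_sup h in m0.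
have /choice[fs fsP] (n : nat) : exists f, normalized f /\ m - energy h f <= n.+1%:R^-1.
  have supE : has_sup [set energy h f | f in @normalized R N].
    split; last exact: energy_has_ubound.
    apply/set0P; apply: contraTneq m0 => E0.
    by rewrite /m /energy_sup E0 sup0 ltxx.
  have n0 : 0 < n.+1%:R^-1 :> R by rewrite invr_gt0.
  have [_ [f fn <-] fE] := sup_adherent n0 supE.
  exists f; split=> //; move: fE; rewrite -/(energy_sup h) -/m => fE.
  by rewrite lerBlDr -lerBlDl ltW.
have fsn n := (fsP n).1; have fsE n := (fsP n).2.
have [U [UU Uoo]] := @ultraFilterLemma _ (\oo : set_system nat) _.
have UP : ProperFilter U by exact: ultra_proper.
have [C C0 hC] := continuous_bounded cptN hc.
have psic n : continuous (autocorrelation (fs n)).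
  by have [fc _] := fsn n; exact: continuous_autocorrelation.
have psi1 n z : `|autocorrelation (fs n) z| <= 1 by exact: normalized_norm.
have /choice[F FP] x : exists l : R, (fun n => eta h (fs n) x) @ U --> l.
  apply: (@ultra_bounded_cvg R U _ C) => n.
  exact: (convolution_norm cptN hc (psic n) hC (psi1 n)).
have /choice[s sP] x : exists l : R, (fun n => autocorrelation (fs n) x) @ U --> l.
  exact: (@ultra_bounded_cvg R U _ 1).
have Fmod e V : (forall x v, V v -> `|h (x + v) - h x| <= e) ->
    forall x v, V v -> `|F (x + v) - F x| <= e.
  move=> hV x v Vv; apply: (cvg_norm_le UP (cvgB (FP (x + v)) (FP x))) => n.
  exact: (eta_modulus cptN hc (fsn n) hV).
exists U, fs, F, s; split=> //.
- split.
    apply: continuous_of_modulus => e e0.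
    have [V V0 hV] := compact_uniform_continuous cptN hc e0.
    by exists V => //; exact: Fmod.
  apply: contrapT => nF; have F0 x : F x = 0.
    by apply/eqP; apply: contrapT => /negP Fx; apply: nF; exists x.
  pose e : R := Num.min 1 (m / 16).
  have e0 : 0 < e by rewrite lt_min ltr01 divr_gt0.
  have [e1 em] : e <= 1 /\ e <= m / 16 by split; rewrite ge_min lexx ?orbT.
  have [V V0 hV] := compact_uniform_continuous cptN hc e0.
  have [t _ tV] := compact_translates cptN V0.
  have U1 : U [set n | forall a, a \in t -> `|eta h (fs n) (- a)| <= e].
    apply: filter_all_seq => a; have := FP (- a); rewrite F0 => /cvgr0Pnorm_le.
    exact.
  have U2 : U [set n | n.+1%:R^-1 < m / 2].
    apply: Uoo; exact: (near_infty_natSinv_lt (PosNum (divr_gt0 m0 (ltr0n R 2)))).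
  have [n [n1 n2]] := filter_ex (filterI U1 U2).
  have eta2 w : `|eta h (fs n) w| <= 2 * e.
    have [a at_ Vwa] := tV w; have := n1 a at_.
    have := eta_modulus cptN hc (fsn n) hV (- a) Vwa.
    rewrite [- a + _]addrC addrK => h1 h2.
    have : `|eta h (fs n) w| <=
        `|eta h (fs n) w - eta h (fs n) (- a)| + `|eta h (fs n) (- a)|.
      by rewrite -{1}(subrK (eta h (fs n) (- a)) (eta h (fs n) w)) ler_normD.
    by move: h1 h2; lra.
  have ec : continuous (eta h (fs n)).
    by have [fc _] := fsn n; exact: continuous_eta.
  have : energy h (fs n) <= (2 * e) ^+ 2.
    rewrite -(@haar_mean_cst R N ((2 * e) ^+ 2)); apply: haar_mean_le => //.
    - exact: continuous_mul.
    - exact: cst_continuous.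
    - move=> x; rewrite -[X in X <= _]real_normK ?num_real //.
      by rewrite ler_sqr ?nnegrE // mulr_ge0 // ltW.
  have := le_lt_trans (fsE n) n2.
  have : e ^+ 2 <= e by rewrite expr2 ger_pMl.
  move: (energy _ _) => A; lra.
- by move=> y; apply: (cvg_norm_le UP (sP y)) => n; exact: psi1.
- move=> x y; apply/eqP; rewrite -subr_eq0; apply/eqP.
  have dcvg : (fun n => defect h (fs n) y x) @ U -->
      (F (x + y) + F (x - y) - 2 * s y * F x).
    apply: cvgB; first exact: cvgD.
    by apply: cvgM => //; apply: cvgM => //; exact: cvg_cst.
  have d0 : (fun n => defect h (fs n) y x) @ U --> (0 : R).
    by move=> A /(defect_cvg0 cptN hc y x fsn fsE); exact: Uoo.
  exact: (cvg_unique _ dcvg d0).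
Qed.

Definition dalembert (s : N -> R) :=
  forall x y, s (x + y) + s (x - y) = 2 * s x * s y.

Lemma hausdorff_separated_fun a : a != 0 ->
  exists f : N -> R, continuous f /\ f a != f 0.
Proof.
move=> a0; have := hN; rewrite open_hausdorff eq_sym in a0 * => /(_ _ _ a0).
move=> [[A B]] /=; rewrite !inE => -[A0 Ba] [oA _ AB].
have [f [fc _ f0 fA]] := bump_function R cptN hN (open_nbhs_nbhs (conj oA A0)).
exists f; split=> //; rewrite f0; apply/negP => /eqP fa.
have : (A `&` B) a by split=> //; apply: fA; rewrite fa oner_neq0.
by rewrite AB.
Qed.

(** Take [h] to be the difference of [f (. + a)] and [f], where [f] separates [a]
    from 0.  If [s a = 1], the equation at [a] says that [F] is affine along the
    multiples of [a], hence invariant under [a] because it is bounded.  But the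
    sum of [k] values of [F] along these multiples is a limit of differences of
    two values of a bounded convolution, so that [k * F z] is bounded in [k],
    and [F = 0]. *)
Lemma ex_dalembert a : a != 0 -> exists s : N -> R,
  [/\ continuous s, s 0 = 1, dalembert s, forall x, `|s x| <= 1 & s a != 1].
Proof.
move=> a0; have [f [fc fa]] := hausdorff_separated_fun a0.
pose h x := f (x + a) - f x.
have hc : continuous h by apply: continuous_sub => //; exact: continuous_translate.
have h0 : h 0 != 0 by rewrite /h add0r subr_eq0.
have [U [fs [F [s [[UP fsn] FP [Fc [z Fz]] s1 FE]]]]] := ex_extremal_limit hc h0.
have two0 : (2 : R) != 0 by rewrite pnatr_eq0.
have sE y : s y = (F (z + y) + F (z - y)) / (2 * F z).
  by rewrite FE; field.
have s0 : s 0 = 1.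
  by rewrite sE addr0 subr0; field.
exists s; split=> //.
- have -> : s = fun y => (2 * F z)^-1 * (F (z + y) + F (z - y)).
    by apply/funext => y; rewrite sE mulrC.
  apply: continuous_scale; apply: continuous_add; last exact: continuous_reflect.
  have -> : (fun y => F (z + y)) = (fun y => F (y + z)).
    by apply/funext => y; rewrite addrC.
  exact: continuous_translate.
- move=> x y; apply: (mulIf (mulf_neq0 two0 Fz)).
  have := FE z (x + y); have := FE z (x - y).
  have -> : z - (x + y) = z - x - y by rewrite opprD addrA.
  have -> : z - (x - y) = z - x + y by rewrite opprB [y - x]addrC addrA.
  have -> : z + (x - y) = z + x - y by rewrite addrA.
  have -> : z + (x + y) = z + x + y by rewrite addrA.
  have := FE (z + x) y; have := FE (z - x) y.
  by have := congr1 ( *%R (2 * s y)) (FE z x); rewrite /=; lra.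
- apply/negP => /eqP sa.
  have [C C0 FC] := continuous_bounded cptN Fc.
  have dE x : F (x + a + a) - F (x + a) = F (x + a) - F x.
    have := FE (x + a) a; rewrite addrK sa; lra.
  have dkE x k : F (x + a *+ k + a) - F (x + a *+ k) = F (x + a) - F x.
    elim: k => [|k IHk]; first by rewrite mulr0n addr0.
    by rewrite mulrSr addrA dE.
  have FkE x k : F (x + a *+ k) - F x = (F (x + a) - F x) *+ k.
    elim: k => [|k IHk]; first by rewrite !mulr0n addr0 subrr.
    by rewrite !mulrSr -IHk -(dkE x k) addrA; ring.
  have Fa x : F (x + a) = F x.
    apply/eqP; rewrite -subr_eq0; apply/eqP/(@bounded_multiples_eq0 _ _ (C + C)) => k.
    by rewrite -FkE; apply: le_trans (ler_normB _ _) (lerD _ _).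
  have Fak x k : F (x + a *+ k) = F x.
    by elim: k => [|k IHk]; rewrite ?mulr0n ?addr0 // mulrSr addrA Fa.
  have [B B0 fB] := continuous_bounded cptN fc.
  have psic n : continuous (autocorrelation (fs n)).
    by have [fnc _] := fsn n; exact: continuous_autocorrelation.
  have psi1 n x : `|autocorrelation (fs n) x| <= 1 by exact: normalized_norm.
  have hE n x : eta h (fs n) x = eta f (fs n) (x + a) - eta f (fs n) x.
    have c1 y : continuous (fun z => f (y - z) * autocorrelation (fs n) z).
      by apply: continuous_mul => //; exact: continuous_reflect.
    rewrite /convolution -(haar_meanB cptN (@c1 (x + a)) (@c1 x)); congr M.
    by apply/funext => y; rewrite /h mulrBl addrAC.
  have Fz0 : F z = 0.
    apply: (@bounded_multiples_eq0 _ _ (B + B)) => k.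
    have kcvg : (fun n => eta f (fs n) (z + a *+ k) - eta f (fs n) z) @ U --> F z *+ k.
      elim: k => [|k IHk].
        rewrite mulr0n addr0 (_ : (fun n => _) = fun=> 0).
          exact: cvg_cst.
        by apply/funext => n; rewrite subrr.
      have step n : eta f (fs n) (z + a *+ k.+1) - eta f (fs n) z =
          eta f (fs n) (z + a *+ k) - eta f (fs n) z + eta h (fs n) (z + a *+ k).
        by rewrite hE mulrSr addrA; ring.
      rewrite (funext step) mulrSr -{2}(Fak z k); exact: cvgD.
    apply: (cvg_norm_le UP kcvg) => n.
    by apply: le_trans (ler_normB _ _) (lerD _ _); exact: (convolution_norm cptN fc).
  by move: Fz; rewrite Fz0 eqxx.
Qed.
End dalembert.

(** * The circle group *)

Section circle.
Variable R : realType.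

Record circle := Circle { circle_val : R[i]; _ : `|circle_val| == 1 }.

HB.instance Definition _ := [isSub for circle_val].
HB.instance Definition _ := [Choice of circle by <:].

Implicit Types x y z : circle.

Lemma circle_val_inj : injective circle_val.
Proof. exact: val_inj. Qed.

Lemma circle_norm x : `|circle_val x| = 1.
Proof. by case: x => z /= /eqP. Qed.

Lemma circle_neq0 x : circle_val x != 0.
Proof. by rewrite -normr_gt0 circle_norm. Qed.

Fact circle_norm_mul x y : `|circle_val x * circle_val y| == 1.
Proof. by rewrite normrM !circle_norm mulr1. Qed.

Fact circle_norm_inv x : `|(circle_val x)^-1| == 1.
Proof. by rewrite normfV circle_norm invr1. Qed.

Fact circle_norm1 : `|1 : R[i]| == 1.
Proof. by rewrite normr1. Qed.

Definition circle_add x y := Circle (circle_norm_mul x y).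
Definition circle_opp x := Circle (circle_norm_inv x).
Definition circle_zero := Circle circle_norm1.

Fact circle_addA : associative circle_add.
Proof. by move=> x y z; apply: val_inj; rewrite /= mulrA. Qed.

Fact circle_addC : commutative circle_add.
Proof. by move=> x y; apply: val_inj; rewrite /= mulrC. Qed.

Fact circle_add0 : left_id circle_zero circle_add.
Proof. by move=> x; apply: val_inj; rewrite /= mul1r. Qed.

Fact circle_addN : left_inverse circle_zero circle_opp circle_add.
Proof. by move=> x; apply: val_inj; rewrite /= mulVf // circle_neq0. Qed.

(** The group structure is written additively, so that characters form a subgroup
    of a group of functions. *)
HB.instance Definition _ :=
  GRing.isZmodule.Build circle circle_addA circle_addC circle_add0 circle_addN.

Lemma circle_valD x y : circle_val (x + y) = circle_val x * circle_val y.
Proof. by []. Qed.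

Lemma circle_valMn x n : circle_val (x *+ n) = circle_val x ^+ n.
Proof. by elim: n => [|n IHn] //; rewrite mulrS circle_valD IHn exprS. Qed.

Lemma circle_val_sum (I : Type) (r : seq I) (F : I -> circle) :
  circle_val (\sum_(i <- r) F i) = \prod_(i <- r) circle_val (F i).
Proof. by elim/big_rec2: _ => // i y x _ <-. Qed.

Lemma circle_divisible x n : (0 < n)%N -> exists y, y *+ n = x.
Proof.
move=> n0; have nz : `|n.-root (circle_val x)| == 1.
  by rewrite -(@pexpr_eq1 _ _ n) // -normrX rootCK // circle_norm.
by exists (Circle nz); apply: circle_val_inj; rewrite circle_valMn /= rootCK.
Qed.

(** A root of [1 + X + ... + X ^ (n - 1)] is an [n]-th root of 1, and differs from
    1 because [n] does not vanish. *)
Lemma circle_torsion n : (1 < n)%N -> exists x, x <> 0 /\ x *+ n = 0.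
Proof.
move=> n1; have n0 : (0 < n)%N by exact: ltnW.
have /closed_rootP[z] : size (\poly_(i < n) (1 : R[i])) != 1%N.
  by rewrite size_poly_eq ?oner_neq0 // gtn_eqF.
rewrite /root horner_poly => /eqP zE.
have {}zE : \sum_(i < n) z ^+ i = 0.
  by rewrite -[RHS]zE; apply: eq_bigr => i _; rewrite mul1r.
have zn : z ^+ n = 1 by apply/eqP; rewrite -subr_eq0 subrX1 zE mulr0.
have z1 : z != 1.
  apply/eqP => z1; move: zE; rewrite z1.
  under eq_bigr do rewrite expr1n.
  by rewrite sumr_const card_ord => /eqP; rewrite pnatr_eq0 eqn0Ngt n0.
have nz : `|z| == 1 by rewrite -(@pexpr_eq1 _ _ n) // -normrX zn normr1.
exists (Circle nz); split; last by apply: circle_val_inj; rewrite circle_valMn.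
by move=> /(congr1 circle_val) /eqP; rewrite (negPf z1).
Qed.

Definition circle_cos x : R := complex.Re (circle_val x).
Definition circle_sin x : R := complex.Im (circle_val x).

Lemma circle_cosD x y :
  circle_cos (x + y) = circle_cos x * circle_cos y - circle_sin x * circle_sin y.
Proof.
by rewrite /circle_cos /circle_sin circle_valD; case: circle_val; case: circle_val.
Qed.

Lemma circle_sinD x y :
  circle_sin (x + y) = circle_cos x * circle_sin y + circle_sin x * circle_cos y.
Proof.
by rewrite /circle_cos /circle_sin circle_valD; case: circle_val; case: circle_val.
Qed.

Lemma circle_cos2Dsin2 x : circle_cos x ^+ 2 + circle_sin x ^+ 2 = 1.
Proof.
have := add_Re2_Im2 (circle_val x); rewrite circle_norm expr1n => /(congr1 (@complex.Re R)).
by [].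
Qed.

Lemma circle_cosN x : circle_cos (- x) = circle_cos x.
Proof.
have := circle_cosD x (- x); have := circle_sinD x (- x); rewrite subrr.
have := circle_cos2Dsin2 x; rewrite [circle_cos 0]/circle_cos [circle_sin 0]/circle_sin /=.
move: (circle_cos x) (circle_sin x) (circle_cos (- x)) (circle_sin (- x)).
move=> a b c d E1 E2 E3.
have : c * (a ^+ 2 + b ^+ 2) = a * (a * c - b * d) + b * (a * d + b * c) by ring.
by rewrite E1 -E2 -E3 mulr1 mulr0 mulr1 addr0.
Qed.

Lemma circle_sinN x : circle_sin (- x) = - circle_sin x.
Proof.
have := circle_cosD x (- x); have := circle_sinD x (- x); rewrite subrr.
have := circle_cos2Dsin2 x; rewrite [circle_cos 0]/circle_cos [circle_sin 0]/circle_sin /=.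
move: (circle_cos x) (circle_sin x) (circle_cos (- x)) (circle_sin (- x)).
move=> a b c d E1 E2 E3.
have : d * (a ^+ 2 + b ^+ 2) = a * (a * d + b * c) - b * (a * c - b * d) by ring.
by rewrite E1 -E2 -E3 mulr1 mulr0 mulr1 sub0r.
Qed.

Lemma circle_cos0 : circle_cos 0 = 1. Proof. by []. Qed.

Lemma circle_cos_le1 x : circle_cos x <= 1.
Proof. have := circle_cos2Dsin2 x; have := sqr_ge0 (circle_sin x); nra. Qed.

Lemma circle_cos_eq1 x : circle_cos x = 1 -> x = 0.
Proof.
move=> cx; have := circle_cos2Dsin2 x; rewrite cx expr1n => /eqP.
rewrite -subr_eq0 addrAC subrr add0r sqrf_eq0 => /eqP sx; apply: circle_val_inj => /=.
by move: cx sx; rewrite /circle_cos /circle_sin; case: circle_val => a b /= -> ->.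
Qed.

Lemma circle_of_cos_sin (a b : R) : a ^+ 2 + b ^+ 2 = 1 ->
  exists x, circle_cos x = a /\ circle_sin x = b.
Proof.
move=> ab; have nz : `|(a +i* b)%C| == 1 by rewrite normc_def /= ab sqrtr1.
by exists (Circle nz).
Qed.

Lemma circle_eq x y : circle_cos x = circle_cos y -> circle_sin x = circle_sin y -> x = y.
Proof.
rewrite /circle_cos /circle_sin => cE sE; apply: circle_val_inj => /=.
by move: cE sE; case: circle_val; case: circle_val => a b c d /= -> ->.
Qed.

End circle.

(** * Continuous characters *)

Section characters.
Variables (R : realType) (N : topologicalZmodType).
Hypothesis cptN : compact [set: N].
Hypothesis hN : hausdorff_space N.

Local Notation M := (@haar_mean R N).
Local Notation T := (circle R).

Definition character_set : set (N -> T) := [set chi : N -> T |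
  [/\ {morph chi : x y / x - y}, continuous (fun x => circle_cos (chi x)) &
      continuous (fun x => circle_sin (chi x))]].

Section one_character.
Variable chi : N -> T.
Hypothesis chiP : character_set chi.

Lemma character0 : chi 0 = 0.
Proof. by have [chiB _ _] := chiP; rewrite -(subrr 0) chiB subrr. Qed.

Lemma characterD x y : chi (x + y) = chi x + chi y.
Proof.
have [chiB _ _] := chiP.
by rewrite -[y in LHS]opprK chiB -[- y]sub0r chiB character0 sub0r opprK.
Qed.

Lemma characterMz x (k : int) : chi (x *~ k) = chi x *~ k.
Proof.
have chiMn n : chi (x *+ n) = chi x *+ n.
  by elim: n => [|n IHn]; rewrite ?character0 // !mulrS characterD IHn.
have [chiB _ _] := chiP.
case: k => n; rewrite ?NegzE ?mulrNz -!pmulrn ?chiMn //.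
by rewrite -sub0r chiB character0 sub0r chiMn.
Qed.

Lemma continuous_cos_sub c : continuous (fun x => circle_cos (chi x - c)).
Proof.
have [_ cc cs] := chiP.
have -> : (fun x => circle_cos (chi x - c)) =
    fun x => circle_cos c * circle_cos (chi x) + circle_sin c * circle_sin (chi x).
  by apply/funext => x; rewrite circle_cosD circle_cosN circle_sinN; ring.
by apply: continuous_add; exact: continuous_scale.
Qed.

(** A non-trivial character has mean 0, since translation multiplies its mean
    by a value other than 1. *)
Lemma haar_mean_character c : chi <> 0 -> M (fun x => circle_cos (chi x - c)) = 0.
Proof.
move=> chi0; have [_ cc cs] := chiP.
have [b chib] : exists b, chi b <> 0.
  apply: contrapT => nb; apply: chi0; apply/funext => b.
  by apply: contrapT => chib; apply: nb; exists b.
have E1 : M (fun x => circle_cos (chi x)) =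
    circle_cos (chi b) * M (fun x => circle_cos (chi x)) -
    circle_sin (chi b) * M (fun x => circle_sin (chi x)).
  rewrite -{1}(haar_mean_translate cptN b cc) -!haar_meanZ // -haar_meanB //;
    try exact: continuous_scale.
  by congr M; apply/funext => x; rewrite characterD circle_cosD; ring.
have E2 : M (fun x => circle_sin (chi x)) =
    circle_sin (chi b) * M (fun x => circle_cos (chi x)) +
    circle_cos (chi b) * M (fun x => circle_sin (chi x)).
  rewrite -{1}(haar_mean_translate cptN b cs) -!haar_meanZ // -haar_meanD //;
    try exact: continuous_scale.
  by congr M; apply/funext => x; rewrite characterD circle_sinD; ring.
have -> : (fun x => circle_cos (chi x - c)) =
    fun x => circle_cos c * circle_cos (chi x) + circle_sin c * circle_sin (chi x).
  by apply/funext => x; rewrite circle_cosD circle_cosN circle_sinN; ring.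
rewrite haar_meanD //; try exact: continuous_scale.
rewrite !haar_meanZ //.
have cb : circle_cos (chi b) != 1 by apply: contra_notN chib => /eqP; exact: circle_cos_eq1.
move: E1 E2 (circle_cos2Dsin2 (chi b)) cb.
move: (circle_cos (chi b)) (circle_sin (chi b)) => u v.
move: (M (fun x => circle_cos (chi x))) (M (fun x => circle_sin (chi x))).
move=> A B E1 E2 uv u1.
have u10 : 2 * (1 - u) != 0 by rewrite mulf_neq0 ?pnatr_eq0 // subr_eq0 eq_sym.
have A0 : A = 0.
  apply/eqP; rewrite -(mulrI_eq0 _ (mulfI u10)); apply/eqP.
  have -> : 2 * (1 - u) * A = (1 - u) * (A - (u * A - v * B)) - v * (B - (v * A + u * B))
      + (1 - (u ^+ 2 + v ^+ 2)) * A by ring.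
  by rewrite -E1 -E2 uv !subrr !mulr0 mul0r !addr0 subr0.
have B0 : B = 0.
  apply/eqP; rewrite -(mulrI_eq0 _ (mulfI u10)); apply/eqP.
  have -> : 2 * (1 - u) * B = (1 - u) * (B - (v * A + u * B)) + v * (A - (u * A - v * B))
      + (1 - (u ^+ 2 + v ^+ 2)) * B by ring.
  by rewrite -E1 -E2 uv !subrr !mulr0 mul0r !addr0.
by rewrite A0 B0 !mulr0 addr0.
Qed.

End one_character.

Lemma character_set_subgroup : subgroup_set character_set.
Proof.
split.
  split; first by move=> x y; rewrite subrr.
    by rewrite (_ : (fun _ => _) = fun=> circle_cos (0 : T)) //; exact: cst_continuous.
  by rewrite (_ : (fun _ => _) = fun=> circle_sin (0 : T)) //; exact: cst_continuous.
move=> chi psi [chiB cc cs] [psiB pc ps]; split.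
- move=> x y.
  change (chi (x - y) - psi (x - y) = chi x - psi x - (chi y - psi y)).
  by rewrite chiB psiB !opprD !opprK addrACA.
- have -> : (fun x => circle_cos ((chi - psi) x)) = fun x =>
      circle_cos (chi x) * circle_cos (psi x) + circle_sin (chi x) * circle_sin (psi x).
    by apply/funext => x; rewrite circle_cosD circle_cosN circle_sinN; ring.
  by apply: continuous_add; exact: continuous_mul.
- have -> : (fun x => circle_sin ((chi - psi) x)) = fun x =>
      circle_sin (chi x) * circle_cos (psi x) - circle_cos (chi x) * circle_sin (psi x).
    by apply/funext => x; rewrite circle_sinD circle_cosN circle_sinN; ring.
  by apply: continuous_sub; exact: continuous_mul.
Qed.

(** If [s] is the cosine of [theta], the difference of [s (x + b)] and [s (x - b)]
    is [- 2 * sin (theta b) * sin (theta x)]: it gives the imaginary part of the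
    character up to the factor [K], which is nonzero for a suitable [b] unless
    [s ^+ 2 = 1] everywhere. *)
Lemma dalembert_character (s : N -> R) : continuous s -> s 0 = 1 -> dalembert s ->
  (forall x, `|s x| <= 1) ->
  exists2 chi, character_set chi & forall x, circle_cos (chi x) = s x.
Proof.
move=> sc s0 sD s1.
have sN x : s (- x) = s x by have := sD 0 x; rewrite add0r sub0r s0; lra.
suff [S [Sc SN S2 SA SB]] : exists S : N -> R, [/\ continuous S, forall x, S (- x) = - S x,
    forall x, s x ^+ 2 + S x ^+ 2 = 1,
    forall x y, s (x + y) = s x * s y - S x * S y &
    forall x y, S (x + y) = s x * S y + S x * s y].
  have /choice[chi chiP] x : exists t : T, circle_cos t = s x /\ circle_sin t = S x.
    exact: circle_of_cos_sin.
  have chic x : circle_cos (chi x) = s x by have [] := chiP x.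
  have chis x : circle_sin (chi x) = S x by have [] := chiP x.
  exists chi => //; split.
  - move=> x y; apply: circle_eq.
      by rewrite circle_cosD circle_cosN circle_sinN !chic !chis SA sN SN; ring.
    by rewrite circle_sinD circle_cosN circle_sinN !chic !chis SB sN SN; ring.
  - by rewrite (funext chic).
  - by rewrite (funext chis).
have [s21|] := pselect (forall b, s b ^+ 2 = 1).
  exists (fun=> 0); split=> // [||x|x y|x y]; rewrite ?oppr0 ?mulr0 ?mul0r ?subr0 ?addr0 //.
  - exact: cst_continuous.
  - by rewrite expr0n addr0.
  - have := sD x y; have := s1 (x + y); have := s1 (x - y).
    rewrite !ler_norml => /andP[? ?] /andP[? ?].
    have : (s x * s y) ^+ 2 = 1 by rewrite exprMn !s21 mulr1.
    move=> /eqP; rewrite sqrf_eq1 => /orP[] /eqP; lra.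
move=> /existsNP[b sb].
have sb1 : 0 < 1 - s b ^+ 2.
  rewrite subr_gt0 lt_neqAle; apply/andP; split; first exact/eqP.
  by rewrite -[X in X <= _]real_normK ?num_real // exprn_ile1.
pose K := 2 * Num.sqrt (1 - s b ^+ 2).
have K2 : K ^+ 2 = 4 * (1 - s b ^+ 2).
  by rewrite exprMn sqr_sqrtr ?(ltW sb1) //; congr (_ * _); rewrite expr2 -natrM.
have K0 : K != 0 by rewrite mulf_neq0 ?pnatr_eq0 // gt_eqF // sqrtr_gt0.
pose S x := K^-1 * (s (x + b) - s (x - b)).
have SN x : S (- x) = - S x.
  by rewrite /S -(sN (- x + b)) -(sN (- x - b)) !opprD !opprK; ring.
have sbb : s (b + b) = 2 * s b ^+ 2 - 1 by have := sD b b; rewrite subrr s0; lra.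
have prod p q : s p * s q = (s (p + q) + s (p - q)) / 2 by rewrite sD; field.
have SS x y : S x * S y = - (s (x + y) - s (x - y)) / 2.
  have E : (s (x + b) - s (x - b)) * (s (y + b) - s (y - b)) =
      (s (b + b) - 1) * (s (x + y) - s (x - y)).
    have E1 := sD (x + y) (b + b); have E2 := sD (x - y) (b + b).
    rewrite mulrBl !mulrBr !prod.
    have -> : x + b + (y + b) = x + y + (b + b) by rewrite addrACA.
    have -> : x + b - (y + b) = x - y by rewrite opprD addrACA subrr addr0.
    have -> : x + b + (y - b) = x + y by rewrite addrACA subrr addr0.
    have -> : x + b - (y - b) = x - y + (b + b) by rewrite opprB [b - y]addrC addrACA.
    have -> : x - b + (y + b) = x + y by rewrite addrACA addNr addr0.
    have -> : x - b - (y + b) = x - y - (b + b) by rewrite !opprD addrACA.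
    have -> : x - b + (y - b) = x + y - (b + b) by rewrite opprD addrACA.
    have -> : x - b - (y - b) = x - y by rewrite opprD opprK addrACA addNr addr0.
    lra.
  rewrite /S mulrACA E -expr2 exprVn K2 sbb; field.
  by rewrite gt_eqF.
have sA x y : s (x + y) = s x * s y - S x * S y by rewrite SS prod; field.
exists S; split=> //.
- apply: continuous_scale; apply: continuous_sub; exact: continuous_translate.
- move=> x; have := sA x (- x); rewrite subrr s0 sN SN; lra.
- move=> x y; suff E : s (x + y + b) - s (x + y - b) =
      s x * (s (y + b) - s (y - b)) + (s (x + b) - s (x - b)) * s y.
    by rewrite /S E; ring.
  rewrite mulrBr mulrBl !prod.
  have -> : x + (y + b) = x + y + b by rewrite addrA.
  have -> : x - (y + b) = x - y - b by rewrite opprD addrA.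
  have -> : x + (y - b) = x + y - b by rewrite addrA.
  have -> : x - (y - b) = x - y + b by rewrite opprB [b - y]addrC addrA.
  have -> : x + b + y = x + y + b by rewrite addrAC.
  have -> : x + b - y = x - y + b by rewrite addrAC.
  have -> : x - b + y = x + y - b by rewrite addrAC.
  have -> : x - b - y = x - y - b by rewrite addrAC.
  by field.
Qed.

Lemma ex_character a : a != 0 -> exists2 chi, character_set chi & chi a != 0.
Proof.
move=> /(ex_dalembert R cptN hN)[s [sc s0 sD s1 sa]].
have [chi chiP chic] := dalembert_character sc s0 sD s1; exists chi => //.
by apply: contraNneq sa => chia; rewrite -chic chia.
Qed.

End characters.

(** * Homomorphisms of the character group are evaluations *)

(** The ratio of consecutive central binomial coefficients is
    [2 * (2 * k + 1) / (k + 1)]. *)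
Lemma exp4_le_central_bin k : (4 ^ k <= k.*2.+1 * 'C(k.*2, k))%N.
Proof.
elim: k => [|k IHk] //.
have e1 := mul_bin_diag k.*2.+1 k; have e2 := mul_bin_diag k.*2.+2 k.
rewrite /= in e1 e2.
have e3 : 'C(k.*2.+1, k) = 'C(k.*2.+1, k.+1).
  by rewrite -bin_sub; [congr binomial|]; lia.
rewrite doubleS expnS; rewrite -e3 in e1; nia.
Qed.

Section linear_times_geometric.
Variable R : realType.

(** By induction on [n], with [q] replaced by its square root [p]: the factor
    [(2 * k + 1) * p ^+ k] is bounded by Bernoulli's inequality. *)
Lemma power_geometric_bounded n (q : R) : 0 < q -> q < 1 ->
  exists C, forall k, (k.*2.+1)%:R ^+ n * q ^+ k <= C.
Proof.
elim: n q => [|n IHn] q q0 q1.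
  by exists 1 => k; rewrite expr0 mul1r exprn_ile1 // ltW.
pose p := Num.sqrt q; have p0 : 0 < p by rewrite sqrtr_gt0.
have p1 : p < 1 by rewrite -sqrtr1 ltr_sqrt.
have pq : p * p = q by rewrite -expr2 sqr_sqrtr // ltW.
have [C CP] := IHn p p0 p1.
pose d := p^-1 - 1; have d0 : 0 < d by rewrite subr_gt0 invf_gt1.
have lin k : k%:R * d * p ^+ k <= 1.
  have : 1 + k%:R * d <= (p^-1) ^+ k.
    elim: k => [|k IHk]; first by rewrite mul0r addr0 expr0.
    have p1' : 0 < p^-1 by rewrite invr_gt0.
    have dE : p^-1 = 1 + d by rewrite addrC subrK.
    rewrite exprS; apply: le_trans (ler_wpM2l (ltW p1') IHk); rewrite {1}dE -natr1.
    have k0 : 0 <= (k%:R : R) by [].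
    have : 0 <= k%:R * (d * d) by rewrite !mulr_ge0 ?(ltW d0).
    by lra.
  rewrite exprVn => h; have pk0 : 0 < p ^+ k by rewrite exprn_gt0.
  rewrite -ler_pdivlMr // mul1r; apply: le_trans h; by rewrite lerDr.
have lin2 k : (k.*2.+1)%:R * p ^+ k <= 2 / d + 1.
  rewrite -natr1 -muln2 natrM mulrDl mul1r lerD //; last by rewrite exprn_ile1 // ltW.
  rewrite ler_pdivlMr // [_ * 2]mulrC -!mulrA ger_pMr // [p ^+ k * d]mulrC mulrA.
  exact: lin.
exists (C * (2 / d + 1)) => k.
rewrite -pq exprMn exprS [_%:R * _]mulrC mulrACA ler_pM ?mulr_ge0 ?exprn_ge0 ?(ltW p0) //.
Qed.

Lemma geometric_eventually_lt n (q : R) : 0 <= q -> q < 1 ->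
  exists k, (k.*2.+1)%:R ^+ n * q ^+ k < 1.
Proof.
move=> q0 q1; have [->|qn0] := eqVneq q 0.
  by exists 1%N; rewrite expr1 mulr0 ltr01.
have {qn0}q0 : 0 < q by rewrite lt_neqAle eq_sym qn0.
have [C CP] := power_geometric_bounded n.+1 q0 q1.
apply: contrapT => nk; have big k : 1 <= (k.*2.+1)%:R ^+ n * q ^+ k.
  by rewrite leNgt; apply/negP => lt1; apply: nk; exists k.
have C0 : 0 <= C by apply: le_trans (CP 0%N); rewrite mulr_ge0 ?exprn_ge0 // ltW.
have := archi_boundP C0; set k := Num.bound C => Ck.
have := CP k; rewrite exprS -mulrA => /(le_trans (ler_wpM2l (ler0n _ _) (big k))).
rewrite mulr1 leNgt => /negP; apply; apply: lt_le_trans Ck _.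
by rewrite ler_nat; lia.
Qed.

End linear_times_geometric.

Lemma complex_ReD (R : realType) (x y : R[i]) :
  complex.Re (x + y) = complex.Re x + complex.Re y.
Proof. by case: x; case: y. Qed.

Lemma complex_Re_sum (R : realType) (I : finType) (F : I -> R[i]) :
  complex.Re (\sum_i F i) = \sum_i complex.Re (F i).
Proof. by elim/big_rec2: _ => // i y x _ <-; rewrite complex_ReD. Qed.

Lemma complex_ReMn (R : realType) (z : R[i]) n :
  complex.Re (z *+ n) = complex.Re z *+ n.
Proof. by elim: n => [|n IHn] //; rewrite !mulrS complex_ReD IHn. Qed.

(** For [v] on the unit circle, [2 + v + v^-1 = (1 + v) ^+ 2 / v]. *)
Lemma circle_cos_binomial (R : realType) (t : circle R) k :
  ((2 + 2 * circle_cos t) ^+ k)%:C%C =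
  \sum_(a < k.*2.+1) circle_val (t *+ a - t *+ k) *+ 'C(k.*2, a).
Proof.
have sq : (2 + 2 * circle_cos t)%:C%C * circle_val t = (circle_val t + 1) ^+ 2.
  have := circle_cos2Dsin2 t; rewrite /circle_cos /circle_sin.
  case: (circle_val t) => a b /= ab.
  apply/eqP; rewrite eq_complex /=; apply/andP; split; apply/eqP; last by ring.
  have -> : (a + 1) * (a + 1) - (b + 0) * (b + 0) =
    2 * a + 2 * a ^+ 2 + (1 - (a ^+ 2 + b ^+ 2)) by ring.
  rewrite ab; ring.
have vk0 : circle_val t ^+ k != 0 by rewrite expf_neq0 // circle_neq0.
apply: (mulIf vk0); rewrite rmorphXn /= -exprMn sq -exprM mul2n exprD1n.
rewrite mulr_suml; apply: eq_bigr => a _; rewrite mulrnAl; congr (_ *+ _).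
by rewrite !circle_valMn divfK.
Qed.

Lemma prod_circle_cos_expand (R : realType) n k (t : 'I_n -> circle R) :
  \prod_j (2 + 2 * circle_cos (t j)) ^+ k =
  \sum_(f : {ffun 'I_n -> 'I_k.*2.+1})
    circle_cos (\sum_j (t j *+ f j - t j *+ k)) *+ (\prod_j 'C(k.*2, f j))%N.
Proof.
have -> : \prod_j (2 + 2 * circle_cos (t j)) ^+ k =
    complex.Re (\prod_j ((2 + 2 * circle_cos (t j)) ^+ k)%:C%C).
  by rewrite -rmorph_prod.
under eq_bigr do rewrite circle_cos_binomial.
rewrite bigA_distr_bigA complex_Re_sum; apply: eq_bigr => f _.
rewrite /circle_cos circle_val_sum -complex_ReMn; congr complex.Re.
elim/big_rec3: _ => [//|j x y m _ ->].
by rewrite /= mulrnAl mulrnAr -mulrnA mulnC.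
Qed.

Section duality.
Variables (R : realType) (N : topologicalZmodType).
Hypothesis cptN : compact [set: N].
Hypothesis hN : hausdorff_space N.

Local Notation M := (@haar_mean R N).
Local Notation T := (circle R).
Local Notation C := (@character_set R N).

Lemma continuous_sum (I : Type) (r : seq I) (f : I -> N -> R) :
  (forall i, continuous (f i)) -> continuous (fun x => \sum_(i <- r) f i x).
Proof.
move=> fc; elim: r => [|i r IHr].
  under eq_fun do rewrite big_nil.
  exact: cst_continuous.
under eq_fun do rewrite big_cons.
exact: continuous_add.
Qed.

Lemma continuous_prod (I : Type) (r : seq I) (f : I -> N -> R) :
  (forall i, continuous (f i)) -> continuous (fun x => \prod_(i <- r) f i x).
Proof.
move=> fc; elim: r => [|i r IHr].
  under eq_fun do rewrite big_nil.
  exact: cst_continuous.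
under eq_fun do rewrite big_cons.
exact: continuous_mul.
Qed.

Lemma haar_mean_sum (I : Type) (r : seq I) (f : I -> N -> R) :
  (forall i, continuous (f i)) ->
  M (fun x => \sum_(i <- r) f i x) = \sum_(i <- r) M (f i).
Proof.
move=> fc; elim: r => [|i r IHr].
  under eq_fun do rewrite big_nil.
  by rewrite big_nil haar_mean_cst.
under eq_fun do rewrite big_cons.
by rewrite big_cons -IHr haar_meanD //; exact: continuous_sum.
Qed.

Variable phi : (N -> T) -> T.
Hypothesis phiB : forall chi psi, C chi -> C psi -> phi (chi - psi) = phi chi - phi psi.

Let CS : subgroup_set C := @character_set_subgroup R N.

Let phi0 : phi 0 = 0.
Proof. by have [C0 _] := CS; rewrite -(subrr 0) phiB // subrr. Qed.

Let phiD chi psi : C chi -> C psi -> phi (chi + psi) = phi chi + phi psi.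
Proof.
move=> Cchi Cpsi; have [C0 _] := CS.
rewrite -[psi in LHS]opprK phiB //; last exact: subgroup_setN.
by rewrite -[- psi]sub0r phiB // phi0 sub0r opprK.
Qed.

Let phiMn chi n : C chi -> phi (chi *+ n) = phi chi *+ n.
Proof.
move=> Cchi; elim: n => [|n IHn] //; rewrite !mulrS phiD ?IHn //.
exact: subgroup_setMn.
Qed.

Let phi_sum (I : Type) (r : seq I) (f : I -> N -> T) :
  (forall i, C (f i)) -> phi (\sum_(i <- r) f i) = \sum_(i <- r) phi (f i).
Proof.
move=> Cf; elim: r => [|i r IHr]; first by rewrite !big_nil.
by rewrite !big_cons phiD // ?IHr //; exact: subgroup_set_sum.
Qed.

(** Were the values [phi (chi j)] not attained simultaneously, the product [F] of
    the [2 + 2 * cos (chi j - phi (chi j))] would have a maximum [rho] less than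
    [4 ^ n], and the mean of [F ^+ k] would be at most [rho ^+ k].  But [F ^+ k]
    is a combination, with nonnegative coefficients, of the real parts of the
    [psi - phi psi] for characters [psi].  Their means are 0 when [psi] is not
    trivial, and 1 when it is, because [phi] then vanishes at [psi].  So the mean
    is at least the coefficient of the index [f0], for which [psi] is formally
    trivial: the [n]-th power of a central binomial coefficient. *)
Lemma finite_evaluation n (chi : 'I_n -> N -> T) : (forall j, C (chi j)) ->
  exists y, forall j, chi j y = phi (chi j).
Proof.
move=> Cchi; apply: contrapT => ny.
pose t j y := chi j y - phi (chi j).
pose F y := \prod_j (2 + 2 * circle_cos (t j y)).
have tc j : continuous (fun y => 2 + 2 * circle_cos (t j y)).
  apply: continuous_add; first exact: cst_continuous.
  by apply: continuous_scale; exact: continuous_cos_sub.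
have Fc : continuous F by exact: continuous_prod.
have fac0 j y : 0 <= 2 + 2 * circle_cos (t j y).
  have := circle_cos2Dsin2 (t j y); have := sqr_ge0 (circle_sin (t j y)); nra.
have fac4 j y : 2 + 2 * circle_cos (t j y) <= 4.
  by have := circle_cos_le1 (t j y); lra.
have F4 y : F y < 4 ^+ n.
  have [j tj] : exists j, chi j y <> phi (chi j).
    apply: contrapT => nj; apply: ny; exists y => j.
    by apply: contrapT => tj; apply: nj; exists j.
  have lt4 : 2 + 2 * circle_cos (t j y) < 4.
    have := circle_cos_le1 (t j y).
    rewrite le_eqVlt => /orP[/eqP/circle_cos_eq1/eqP|]; last by lra.
    by rewrite subr_eq0 => /eqP.
  rewrite -[n in 4 ^+ n]card_ord -prodr_const /F (bigD1 j) //= [ltRHS](bigD1 j) //=.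
  apply: le_lt_trans (_ : _ <= (2 + 2 * circle_cos (t j y)) * \prod_(i < n | i != j) 4) _.
    by rewrite ler_wpM2l // ler_prod // => i _; rewrite fac0 fac4.
  by rewrite ltr_pM2r // prodr_gt0.
have F0 y : 0 <= F y by apply: prodr_ge0.
have [y0 _ y0max] : exists2 c, c \in [set: N] & forall y, y \in [set: N] -> F y <= F c.
  apply: compact_EVT_max => //; first by exists 0.
  exact: continuous_subspaceT.
have Fle y : F y <= F y0 by apply: y0max; rewrite inE.
set rho := F y0 in Fle.
have pos4 : 0 < 4 ^+ n :> R by rewrite exprn_gt0.
have q0 : 0 <= rho / 4 ^+ n by rewrite divr_ge0 ?F0 // ltW.
have q1 : rho / 4 ^+ n < 1 by rewrite ltr_pdivrMr // mul1r F4.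
have [k] := geometric_eventually_lt n q0 q1.
apply/negP; rewrite -leNgt expr_div_n mulrA ler_pdivlMr ?exprn_gt0 // mul1r.
have Fkc : continuous (fun y => F y ^+ k).
  have -> : (fun y => F y ^+ k) = fun y => \prod_(i < k) F y.
    by apply/funext => y; rewrite prodr_const card_ord.
  exact: continuous_prod.
have Mub : M (fun y => F y ^+ k) <= rho ^+ k.
  rewrite -(@haar_mean_cst R N (rho ^+ k)); apply: haar_mean_le => //.
    exact: cst_continuous.
  by move=> y; rewrite lerXn2r ?nnegrE // F0.
suff Mlb : ('C(k.*2, k) ^ n)%N%:R <= M (fun y => F y ^+ k).
  have b4 : 4 ^+ k <= k.*2.+1%:R * 'C(k.*2, k)%:R :> R.
    by rewrite -natrX -natrM ler_nat exp4_le_central_bin.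
  rewrite exprAC; apply: le_trans (lerXn2r n _ _ b4) _;
    rewrite ?nnegrE ?exprn_ge0 ?mulr_ge0 //.
  rewrite exprMn ler_wpM2l ?exprn_ge0 // -natrX; exact: le_trans Mub.
pose psi (f : {ffun 'I_n -> 'I_k.*2.+1}) := \sum_j (chi j *+ f j - chi j *+ k).
have Cj (f : {ffun 'I_n -> 'I_k.*2.+1}) j : C (chi j *+ nat_of_ord (f j) - chi j *+ k).
  by have [_] := CS; apply; exact: subgroup_setMn.
have Cpsi f : C (psi f) by apply: subgroup_set_sum => // j; exact: (Cj f).
have FkE y : F y ^+ k = \sum_(f : {ffun 'I_n -> 'I_k.*2.+1}) (\prod_j 'C(k.*2, f j))%N%:R *
    circle_cos (psi f y - phi (psi f)).
  rewrite -prodrXl prod_circle_cos_expand; apply: eq_bigr => f _.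
  rewrite -[LHS]mulr_natl; congr (_ * circle_cos _).
  rewrite /psi phi_sum; last exact: (Cj f).
  rewrite fct_sumE -sumrB; apply: eq_bigr => j _.
  rewrite phiB ?phiMn //; [|exact: subgroup_setMn|exact: subgroup_setMn].
  change ((chi j y - phi (chi j)) *+ f j - (chi j y - phi (chi j)) *+ k =
    (chi j *+ f j) y - (chi j *+ k) y - (phi (chi j) *+ f j - phi (chi j) *+ k)).
  by rewrite !natmulfctE !mulrnBl !opprD !opprK addrACA.
rewrite (funext FkE) haar_mean_sum; last first.
  by move=> f; apply: continuous_scale; exact: continuous_cos_sub.
have term (f : {ffun 'I_n -> 'I_k.*2.+1}) : M (fun y => (\prod_j 'C(k.*2, f j))%N%:R *
      circle_cos (psi f y - phi (psi f))) =
    if psi f == 0 then (\prod_j 'C(k.*2, f j))%N%:R else 0.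
  rewrite haar_meanZ //; last exact: continuous_cos_sub.
  case: eqP => [pf|/(haar_mean_character cptN (Cpsi f)) ->]; last by rewrite mulr0.
  have cos1 y : circle_cos (psi f y - phi (psi f)) = 1.
    by rewrite pf (phi0 : phi 0 = 0) subr0.
  by rewrite (funext cos1) haar_mean_cst mulr1.
under eq_bigr do rewrite term.
pose f0 : {ffun 'I_n -> 'I_k.*2.+1} := [ffun=> inord k].
have f0k j : f0 j = k :> nat by rewrite ffunE inordK //; lia.
rewrite (bigD1 f0) //= ifT; last first.
  by apply/eqP/big1 => j _; rewrite f0k subrr.
under eq_bigr do rewrite f0k.
rewrite prod_nat_const card_ord lerDl sumr_ge0 // => f _.
by case: ifP.
Qed.

(** The sets where the values of finitely many characters are those of [phi] are
    closed and nonempty, and the group is compact. *)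
Lemma evaluation : exists y, forall chi, C chi -> chi y = phi chi.
Proof.
apply: contrapT => ny.
have [x _|s sP] := compact_seq_cover
    (f := fun chi => [set y | C chi /\ chi y <> phi chi]) cptN.
  have [chi [Cchi chix]] : exists chi, C chi /\ chi x <> phi chi.
    apply: contrapT => nchi; apply: ny; exists x => chi Cchi.
    by apply: contrapT => chix; apply: nchi; exists chi.
  exists chi; pose g y := circle_cos (chi y - phi chi).
  have gc : continuous g by exact: continuous_cos_sub.
  have gx : g x < 1.
    rewrite lt_neqAle circle_cos_le1 andbT; apply/eqP => /circle_cos_eq1/eqP.
    by rewrite subr_eq0 => /eqP.
  have := gc x; move=> /cvgr_lt /(_ _ gx); apply: filterS => y gy; split=> // chiy.
  by move: gy; rewrite /g chiy subrr circle_cos0 ltxx.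
pose r := [seq chi <- s | `[< C chi >]].
pose f (j : 'I_(size r)) := tnth (in_tuple r) j.
have Cf j : C (f j).
  by have := mem_tnth j (in_tuple r); rewrite mem_filter => /andP[/asboolP].
have [y yP] := finite_evaluation Cf.
have [chi chis [Cchi]] := sP y I; apply.
have /tnthP[j ->] : chi \in in_tuple r by rewrite mem_filter chis andbT; apply/asboolP.
exact: yP.
Qed.

End duality.

(** * Subgroups converging to 0 in a compact group *)

Section spread_points.
Variables (R : realType) (N : topologicalZmodType).
Hypothesis cptN : compact [set: N].
Hypothesis hN : hausdorff_space N.

Local Notation T := (circle R).
Local Notation C := (@character_set R N).

Lemma character_cos_nbhs (chi : N -> T) x (c : R) : C chi ->
  c < circle_cos (chi x) -> nbhs x [set y | c < circle_cos (chi y)].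
Proof. by move=> [_ cc _] cx; have /cvgr_gt := cc x; apply. Qed.

(** Outside an open neighbourhood of 0, which is a compact set, every point is
    outside the kernel of some character. *)
Lemma character_kernel_nbhs V : nbhs (0 : N) V -> exists s : seq (N -> T),
  (forall chi, chi \in s -> C chi) /\
  forall x, (forall chi, chi \in s -> chi x = 0) -> V x.
Proof.
move=> V0; have cptV : compact (~` V°).
  by apply: (subclosed_compact _ cptN) => //; apply: open_closedC; exact: open_interior.
have [x Vx|s sP] := compact_seq_cover
    (f := fun chi => [set y | C chi /\ circle_cos (chi y) < 1]) cptV.
  have x0 : x != 0 by apply: contra_notN Vx => /eqP ->.
  have [chi Cchi chix] := ex_character R cptN hN x0; exists chi.
  have cx : circle_cos (chi x) < 1.
    rewrite lt_neqAle circle_cos_le1 andbT.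
    by apply: contraNneq chix => /circle_cos_eq1 ->.
  by have [_ cc _] := Cchi; have /cvgr_lt/(_ _ cx) := cc x; apply: filterS => y cy.
exists [seq chi <- s | `[< C chi >]]; split.
  by move=> chi; rewrite mem_filter => /andP[/asboolP].
move=> x chix; apply: contrapT => Vx.
have [|chi chis [Cchi]] := sP x; first by move=> /interior_subset.
by rewrite chix ?circle_cos0 ?ltxx // mem_filter chis andbT; apply/asboolP.
Qed.

(** The subgroups in question are generated by the points [y i], at which the
    characters take the values given by the coordinates of [spread_homs].  The
    neighbourhoods [Q i n] of 0 are defined by the character [i]; their
    intersection is trivial because these characters generate all others. *)
Theorem spread_points : exists (I : Type) (y : I -> N) (Q : I -> nat -> set N),
  [/\ forall i, y i != 0,
      forall V, nbhs 0 V -> finite_set [set i | ~ forall k : int, V (y i *~ k)],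
      forall i n, nbhs 0 (Q i n) &
      forall x, (forall i n, Q i n x) -> x = 0].
Proof.
have [J [F [JC F1 FB Ffin Jgen]]] := spread_homs (@character_set_subgroup R N)
  (@circle_divisible R) (@circle_torsion R).
have /choice[y yP] i : exists y, forall chi, C chi -> chi y = F i chi.
  exact: (evaluation cptN (phi := F i) (FB i)).
exists {i | J i}, (fun i => y (sval i)).
exists (fun i n => [set x | 1 - n.+1%:R^-1 < circle_cos (sval i x)]); split.
- move=> [i Ji] /=; apply: contra_notN (F1 _ Ji) => /eqP yi.
  by rewrite -yP ?yi ?(character0 (JC _ Ji)) //; exact: JC.
- move=> V /character_kernel_nbhs[s [sC sV]].
  have fin : finite_set [set i | exists2 chi, chi \in s & F i chi <> 0].
    have -> : [set i | exists2 chi, chi \in s & F i chi <> 0] =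
        \bigcup_(chi in [set` s]) [set i | F i chi <> 0].
      by apply/seteqP; split=> i [chi chis Fi]; exists chi.
    by apply: bigcup_finite => // chi /sC; exact: Ffin.
  have inj : set_inj (@sval _ J @^-1` [set i | exists2 chi, chi \in s & F i chi <> 0])
      (@sval _ J).
    by move=> [i Ji] [j Jj] _ _ /= ij; apply: eq_exist.
  apply: sub_finite_set (finite_preimage inj fin) => -[i Ji] /= iV.
  apply: contrapT => nF; apply: iV => k; apply: sV => chi chis.
  rewrite (characterMz (sC _ chis)) yP; last exact: sC.
  suff -> : F i chi = 0 by rewrite mul0rz.
  by apply: contrapT => Fi; apply: nF; exists chi.
- move=> [i Ji] n /=; apply: character_cos_nbhs; first exact: JC.
  by rewrite (character0 (JC _ Ji)) circle_cos0 ltrBlDr ltrDl invr_gt0.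
- move=> x Qx; apply/eqP; apply: contrapT => /negP x0.
  have [chi Cchi chix] := ex_character R cptN hN x0.
  have : [set chi : N -> T | chi x = 0] chi.
    apply: Jgen Cchi => //.
      split=> // a b /= ax bx; change (a x - b x = 0); by rewrite ax bx subrr.
    move=> i Ji; apply: circle_cos_eq1; apply/eqP; rewrite eq_le circle_cos_le1 /=.
    apply/ler_addgt0Pl => e e0.
    have [n _ /(_ n (leqnn n)) ne] := near_infty_natSinv_lt (PosNum e0).
    rewrite -lerBlDl; apply: le_trans (ltW (Qx (exist _ i Ji) n)).
    by rewrite lerB // ltW.
  by move=> /= cx; rewrite cx eqxx in chix.
Qed.
End spread_points.

Local Close Scope ring_scope.

(** * Coarser topologies from closed subgroups *)

Section topological_group.
Variable H : topologicalGroupType.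
Implicit Types (x y z : H) (V W : set H).
Local Open Scope group_scope.

Lemma nbhs_mulg x y V : nbhs (x * y) V -> exists P Q : set H,
  [/\ nbhs x P, nbhs y Q & forall p q, P p -> Q q -> V (p * q)].
Proof.
move=> /(@mulg_continuous H (x, y))[[P Q] /= [Px Qy] PQV].
by exists P, Q; split=> // p q Pp Qq; exact: (PQV (p, q)).
Qed.

Lemma nbhs_invg x V : nbhs x^-1 V -> nbhs x [set p | V p^-1].
Proof. exact: invg_continuous. Qed.

Lemma nbhs_divg x y V : nbhs (x * y^-1) V -> exists P Q : set H,
  [/\ nbhs x P, nbhs y Q & forall p q, P p -> Q q -> V (p * q^-1)].
Proof.
move=> /nbhs_mulg[P [Q [Px /nbhs_invg Qy PQV]]].
by exists P, [set q | Q q^-1]; split=> // p q Pp; exact: PQV.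
Qed.

Lemma nbhs_divlg x y V : nbhs (x^-1 * y) V -> exists P Q : set H,
  [/\ nbhs x P, nbhs y Q & forall p q, P p -> Q q -> V (p^-1 * q)].
Proof.
move=> /nbhs_mulg[P [Q [/nbhs_invg Px Qy PQV]]].
by exists [set p | P p^-1], Q; split=> // p q Pp; exact: PQV.
Qed.

Lemma nbhs_mulgr x y V : nbhs (x * y) V -> nbhs x [set p | V (p * y)].
Proof.
move=> /nbhs_mulg[P [Q [Px Qy PQV]]]; apply: filterS Px => p Pp.
by apply: PQV => //; exact: nbhs_singleton.
Qed.

Lemma open_mulgr y V : open V -> open [set p | V (p * y)].
Proof.
rewrite !openE => oV p /= Vpy; apply: nbhs_mulgr; exact: oV.
Qed.

Lemma nbhs_divg_closed V : nbhs 1 V -> exists W, [/\ nbhs 1 W, closed W &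
  forall x y, W x -> W y -> V (x * y^-1)].
Proof.
rewrite -{1}(mulg1 1) -{2}invg1 => /nbhs_divg[P [Q [P1 Q1 PQV]]].
have PQ1 : nbhs 1 (P `&` Q) by exact: filterI.
rewrite -{1}(mulg1 1) -{2}invg1 in PQ1.
have [P' [Q' [P'1 Q'1 PQ']]] := nbhs_divg PQ1.
exists (closure (P' `&` Q')); split.
- by apply: filterS (filterI P'1 Q'1); exact: subset_closure.
- exact: closed_closure.
have sub : closure (P' `&` Q') `<=` P `&` Q.
  move=> x clx; have xPQ : nbhs x [set p | (P' `&` Q') (x^-1 * p)].
    have : nbhs (x^-1 * x) (P' `&` Q') by rewrite mulVg; exact: filterI.
    move=> /nbhs_mulg[A [B [A1 B1 AB]]]; apply: filterS B1 => p Bp.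
    by apply: AB => //; exact: nbhs_singleton.
  have [p [[P'p Q'p] [/= P'xp Q'xp]]] := clx _ xPQ.
  have -> : x = p * (x^-1 * p)^-1 by rewrite invgM invgK mulVKg.
  exact: PQ'.
by move=> x y /sub[Px _] /sub[_ Qy]; exact: PQV.
Qed.

Lemma closure_div (D : set H) : (forall x y, D x -> D y -> D (x * y^-1)) ->
  forall x y, closure D x -> closure D y -> closure D (x * y^-1).
Proof.
move=> Ddiv x y Dx Dy V /nbhs_divg[P [Q [Px Qy PQV]]].
have [a [Da Pa]] := Dx _ Px; have [b [Db Qb]] := Dy _ Qy.
by exists (a * b^-1); split; [exact: Ddiv|exact: PQV].
Qed.

End topological_group.

Section embedding.
Variables (G : topologicalZmodType) (H : topologicalGroupType) (f : G -> H).
Hypothesis hH : hausdorff_space H.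
Hypothesis fM : {morph f : x y / (x + y)%R >-> (x * y)%g}.
Hypothesis fopen : forall A : set G, open A <-> exists2 B : set H, open B & A = f @^-1` B.
Local Open Scope group_scope.

Lemma morph_zero : f 0%R = 1.
Proof. by apply: (mulgI (f 0%R)); rewrite -fM addr0 mulg1. Qed.

Lemma morph_opp x : f (- x)%R = (f x)^-1.
Proof. by apply: (mulgI (f x)); rewrite -fM subrr morph_zero mulgV. Qed.

Lemma morph_sub x y : f (x - y)%R = f x * (f y)^-1.
Proof. by rewrite fM morph_opp. Qed.

Let K := closure (range f).

Lemma range_sub_closure x : K (f x).
Proof. by apply: subset_closure; exists x. Qed.

Lemma closure_range_div x y : K x -> K y -> K (x * y^-1).
Proof.
apply: closure_div => _ _ [a _ <-] [b _ <-].
by exists (a - b)%R; rewrite ?morph_sub.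
Qed.

Lemma closure_range1 : K 1.
Proof. by rewrite -morph_zero; exact: range_sub_closure. Qed.

Lemma closure_rangeC x y : K x -> K y -> x * y = y * x.
Proof.
move=> Kx Ky; apply: hH => A B /nbhs_mulg[P [Q [Px Qy PQA]]].
move=> /nbhs_mulg[Q' [P' [Qy' Px' QPB]]].
have [_ [[a _ <-] [Pa Pa']]] := Kx _ (filterI Px Px').
have [_ [[b _ <-] [Qb Qb']]] := Ky _ (filterI Qy Qy').
by exists (f a * f b); split; [exact: PQA|rewrite -fM addrC fM; exact: QPB].
Qed.

Variable D : set H.
Hypothesis DK : D `<=` K.
Hypothesis D1 : D 1.
Hypothesis Ddiv : forall x y, D x -> D y -> D (x * y^-1).

Let DM x y : D x -> D y -> D (x * y).
Proof.
by move=> Dx Dy; rewrite -[y]invgK; apply: Ddiv => //; rewrite -[y^-1]mul1g; exact: Ddiv.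
Qed.

(** The topology induced on [G] by the quotient of [H] by [D]: its open sets are
    the traces of the open sets of [H] that are unions of cosets of [D]. *)
Definition coarser_open (A : set G) : Prop := exists O : set H,
  [/\ open O, forall x d, O x -> D d -> O (x * d) & A = f @^-1` O].

Lemma saturation_open V : open V ->
  open [set x | exists p d, [/\ V p, D d & x = p * d]] /\
  forall x d, [set x | exists p d, [/\ V p, D d & x = p * d]] x -> D d ->
    [set x | exists p d, [/\ V p, D d & x = p * d]] (x * d).
Proof.
move=> oV; split.
  have -> : [set x | exists p d, [/\ V p, D d & x = p * d]] =
      \bigcup_(d in D) [set x | V (x * d^-1)].
    apply/seteqP; split=> x.
      by move=> [p [d [Vp Dd ->]]]; exists d => //=; rewrite mulgK.
    by move=> [d Dd Vxd]; exists (x * d^-1), d; split=> //; rewrite mulgVK.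
  by apply: bigcup_open => d _; exact: open_mulgr.
move=> _ d [p [e [Vp De ->]]] Dd; exists p, (e * d).
by split=> //; [exact: DM|rewrite mulgA].
Qed.

Fact coarser_openT : coarser_open setT.
Proof. by exists setT; split=> //; exact: openT. Qed.

Fact coarser_openI : setI_closed coarser_open.
Proof.
move=> _ _ [ O [ oO Osat ->]] [P [ oP Psat ->]]; exists (O `&` P); split=> //.
  exact: openI.
by move=> x d [ Ox Px] Dd; split; [exact: Osat|exact: Psat].
Qed.

Fact coarser_open_bigU (I : Type) (A : I -> set G) :
  (forall i, coarser_open (A i)) -> coarser_open (\bigcup_i A i).
Proof.
move=> AP; have /choice[ O OP] := AP; exists (\bigcup_i O i); split.
- by apply: bigcup_open => i _; have [] := OP i.
- by move=> x d [i _ Oix] Dd; exists i => //; have [_ + _] := OP i; apply.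
- by rewrite preimage_bigcup; apply: eq_bigcupr => i _; have [] := OP i.
Qed.

Definition coarser_type : Type := G.
HB.instance Definition _ := Choice.on coarser_type.
HB.instance Definition _ := isOpenTopological.Build coarser_type
  coarser_openT coarser_openI coarser_open_bigU.


Lemma coarser_openE (A : set coarser_type) : open A = coarser_open A.
Proof.
apply/propext; split=> [|oA].
  rewrite openE => oA.
  have -> : A = \bigcup_(B : {B : set G | coarser_open B /\ B `<=` A}) sval B.
    apply/seteqP; split=> x; last by move=> [[B [ oB BA]] _ /= Bx]; exact: BA.
    by move=> /oA[B [ oB Bx BA]]; exists (exist _ B (conj oB BA)).
  by apply: coarser_open_bigU => -[B []].
by rewrite openE => x Ax; exists A; split.
Qed.

Lemma coarser_nbhs_saturation (x : coarser_type) V : nbhs (f x) V ->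
  nbhs x [set y | exists p d, [/\ V p, D d & f y = p * d]].
Proof.
move=> xV; have [ oS Ssat] := saturation_open (open_interior V).
exists (f @^-1` [set x | exists p d, [/\ V° p, D d & x = p * d]]); split.
- by exists [set x | exists p d, [/\ V° p, D d & x = p * d]].
- by exists (f x), 1; split; rewrite ?mulg1.
- by move=> y [p [d [/interior_subset Vp Dd yE]]]; exists p, d.
Qed.

Lemma coarser_nbhsP (x : coarser_type) A : nbhs x A -> exists O : set H,
  [/\ open O, O (f x), forall x d, O x -> D d -> O (x * d) & f @^-1` O `<=` A].
Proof. by move=> [_ [[ O [ oO Osat ->]] Ox OA]]; exists O. Qed.

Let saturate_sub x p d V : K x -> V p -> D d -> x = p * d -> K p.
Proof.
move=> Kx _ Dd xE; have -> : p = x * d^-1 by rewrite xE mulgK.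
by apply: closure_range_div => //; exact: DK.
Qed.

(** Cosets of [D] need not multiply in [H], but all elements involved here lie in
    [K], where they commute with those of [D]. *)
Lemma coarser_group_topology : group_topology (Topological.class coarser_type).
Proof.
split.
- move=> [x y] A /= /coarser_nbhsP[ O [ oO Oxy Osat OA]].
  have : nbhs (f x * f y) O by apply: open_nbhs_nbhs; split=> //; rewrite -fM.
  move=> /nbhs_mulg[P [Q [Px Qy PQO]]].
  exists ([set z | exists p d, [/\ P p, D d & f z = p * d]],
          [set z | exists p d, [/\ Q p, D d & f z = p * d]]).
    by split=> /=; exact: coarser_nbhs_saturation.
  move=> [a b] /= [[p [d [Pp Dd aE]]] [q [e [Qq De bE]]]].
  apply: OA; rewrite /preimage /= fM aE bE.
  have Kq : K q by apply: saturate_sub Qq De bE; exact: range_sub_closure.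
  have -> : p * d * (q * e) = p * q * (d * e).
    by rewrite -!mulgA [d * (q * e)]mulgA (closure_rangeC (DK Dd) Kq) !mulgA.
  by apply: Osat (DM Dd De); exact: PQO.
- move=> x A /= /coarser_nbhsP[ O [ oO Ox Osat OA]].
  have : nbhs (f x)^-1 O by apply: open_nbhs_nbhs; split=> //; rewrite -morph_opp.
  move=> /nbhs_invg/coarser_nbhs_saturation; apply: filterS => y [p [d [ Op Dd yE]]].
  apply: OA; rewrite /preimage /= morph_opp yE.
  have Kp : K p by apply: saturate_sub Op Dd yE; exact: range_sub_closure.
  rewrite (closure_rangeC Kp (DK Dd)) invgM; apply: Osat => //.
  by rewrite -[d^-1]mul1g; exact: Ddiv.
Qed.

Hypothesis Dclosed : closed D.
Hypothesis Dtrivial : forall x, D (f x) -> x = 0%R.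

Lemma coarser_hausdorff : hausdorff_space coarser_type.
Proof.
move=> x y cl; apply: contrapT => xy.
have nDxy : nbhs ((f x)^-1 * f y) (~` D).
  apply: open_nbhs_nbhs; split; first exact: closed_openC.
  rewrite -morph_opp -fM => /Dtrivial /eqP; rewrite addrC subr_eq0 => /eqP yx.
  exact: xy.
have [P [Q [Px Qy PQ]]] := nbhs_divlg nDxy.
have [z [[p [d [Pp Dd zp]]] [q [e [Qq De zq]]]]] :=
  cl _ _ (coarser_nbhs_saturation Px) (coarser_nbhs_saturation Qy).
apply: (PQ p q) => //; have -> : p^-1 * q = d * e^-1; last exact: Ddiv.
by rewrite -[d in RHS](mulKg p) -zp zq -!mulgA mulgV mulg1.
Qed.

Lemma coarser_sub (A : set coarser_type) : open A -> open (A : set G).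
Proof. by rewrite coarser_openE => -[ O [ oO _ AE]]; apply/fopen; exists O. Qed.

(** The topology induced by the quotient by [D] is Hausdorff because [D] is closed
    and meets the image of [G] trivially, and [U] is a neighbourhood of 0 for it
    because [D] is small.  By minimality it is the original topology.  But a
    point of [D] is a limit of points of [G], which converge to 0 for the
    coarser topology; so this point is 1. *)
Lemma small_subgroup_trivial (U : set G) O W :
  (forall Tc : Topological G,
      let G' : topologicalType := Topological.Pack Tc in
      group_topology Tc -> hausdorff_space G' -> (@open G' `<=` @open G) ->
      nbhs (0%R : G') U -> @open G' = @open G) ->
  U = f @^-1` O -> nbhs 1 W -> (forall w d, W w -> D d -> O (w * d)) ->
  forall d, D d -> d = 1.
Proof.
move=> Umin UO W1 WDO d Dd.
have openG : @open coarser_type = @open G.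
  apply: (Umin (Topological.class coarser_type)).
  - exact: coarser_group_topology.
  - exact: coarser_hausdorff.
  - exact: coarser_sub.
  - have : nbhs (f 0%R) W by rewrite morph_zero.
    move=> /coarser_nbhs_saturation; apply: filterS => y [p [e [Wp De yE]]].
    by rewrite UO /preimage /= yE; exact: WDO.
(* A neighbourhood of 1 for the original topology is the trace of an open union
   of cosets [P].  It contains 1, hence [d], so that points of [G] close to [d]
   are also close to 1. *)
apply/esym/hH => A B A1 Bd.
have oA : open (f @^-1` A° : set G) by apply/fopen; exists A°; first exact: open_interior.
rewrite -openG coarser_openE in oA; have [P [ oP Psat AP]] := oA.
have P1 : P 1.
  have : (f @^-1` A°) 0%R by rewrite /preimage /= morph_zero.
  by rewrite AP /preimage /= morph_zero.
have Pd : P d by rewrite -[d]mul1g; exact: Psat.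
have [_ [[a _ <-] [Pa Ba]]] := DK Dd (filterI (open_nbhs_nbhs (conj oP Pd)) Bd).
exists (f a); split=> //; apply: interior_subset.
by have : (f @^-1` P) a by []; rewrite -AP.
Qed.

End embedding.

(** * Points of a locally minimal group in small subgroups *)

(** Abelian subgroups of a possibly noncommutative topological group, bundled so
    that their subspaces can carry the structure of a topological group written
    additively. *)
Record abelian_subgroup (H : topologicalGroupType) := AbelianSubgroup {
  abelian_set : set H;
  abelian_set1 : abelian_set 1%g;
  abelian_set_div : forall x y, abelian_set x -> abelian_set y -> abelian_set (x * y^-1)%g;
  abelian_setC : forall x y, abelian_set x -> abelian_set y -> (x * y = y * x)%g }.

Section abelian_subgroup_type.
Variables (H : topologicalGroupType) (A : abelian_subgroup H).
Local Open Scope group_scope.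

Definition abelian_type : Type := set_type (abelian_set A).
HB.instance Definition _ := Topological.on abelian_type.

Let abelian_valP (x : abelian_type) : abelian_set A (set_val x).
Proof. exact: set_valP. Qed.

Let mk (x : H) (Ax : abelian_set A x) : abelian_type := exist _ x (mem_set Ax).

Let abelian_set_inv x : abelian_set A x -> abelian_set A x^-1.
Proof.
move=> Ax; rewrite -[x^-1]mul1g.
by apply: abelian_set_div => //; exact: abelian_set1.
Qed.

Let abelian_set_mul x y : abelian_set A x -> abelian_set A y -> abelian_set A (x * y).
Proof. by move=> Ax /abelian_set_inv Ay; rewrite -[y]invgK; exact: abelian_set_div. Qed.

Let add (x y : abelian_type) := mk (abelian_set_mul (abelian_valP x) (abelian_valP y)).
Let opp (x : abelian_type) := mk (abelian_set_inv (abelian_valP x)).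
Let zero := mk (abelian_set1 A).

Fact abelian_addA : associative add.
Proof. by move=> x y z; apply: val_inj; rewrite /= mulgA. Qed.

Fact abelian_addC : commutative add.
Proof. by move=> x y; apply: val_inj; apply: abelian_setC; exact: abelian_valP. Qed.

Fact abelian_add0 : left_id zero add.
Proof. by move=> x; apply: val_inj; rewrite /= mul1g. Qed.

Fact abelian_addN : left_inverse zero opp add.
Proof. by move=> x; apply: val_inj; rewrite /= mulVg. Qed.

HB.instance Definition _ := GRing.isZmodule.Build abelian_type
  abelian_addA abelian_addC abelian_add0 abelian_addN.

Fact abelian_sub_continuous :
  continuous (fun p : abelian_type * abelian_type => (p.1 - p.2)%R).
Proof.
move=> [x y] U /nbhs_set_type[V xyV VU].
have [P [Q [Px Qy PQV]]] := nbhs_divg xyV.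
exists (set_val @^-1` P, set_val @^-1` Q) => /=.
  by split; apply/nbhs_set_type; [exists P|exists Q].
by move=> [a b] /= [Pa Qb]; apply: VU; exact: PQV.
Qed.

HB.instance Definition _ :=
  PreTopologicalNmodule_isTopologicalZmodule.Build abelian_type abelian_sub_continuous.

Lemma abelian_hausdorff : hausdorff_space H -> hausdorff_space abelian_type.
Proof.
move=> hH a b ab; apply: val_inj; apply: hH => V W aV bW.
have [c [Vc Wc]] := ab (set_val @^-1` V) (set_val @^-1` W)
  ((nbhs_set_type _ _).2 (ex_intro2 _ _ V aV (fun _ => id)))
  ((nbhs_set_type _ _).2 (ex_intro2 _ _ W bW (fun _ => id))).
by exists (set_val c).
Qed.

Lemma abelian_compact : compact (abelian_set A) -> compact [set: abelian_type].
Proof.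
move=> cptA F FF _.
have FA : (set_val @ F) (abelian_set A).
  apply: (@filterE _ F _ (set_val @^-1` abelian_set A)) => x.
  exact: abelian_valP.
have [p [Ap clp]] := cptA (set_val @ F) _ FA.
exists (mk Ap); split=> // V W FV /nbhs_set_type[W' pW' WW'].
have [_ [[c Vc <-] W'c]] : set_val @` V `&` W' !=set0.
  apply: clp => //; apply: (@filterS _ F _ V (set_val @^-1` (set_val @` V))) => // c Vc.
  by exists c.
by exists c; split=> //; exact: WW'.
Qed.

End abelian_subgroup_type.

Section locally_precompact_group.
Variables (G : topologicalZmodType) (H : topologicalGroupType) (f : G -> H).
Hypothesis hH : hausdorff_space H.
Hypothesis lcH : locally_compact [set: H].
Hypothesis fM : {morph f : x y / (x + y)%R >-> (x * y)%g}.
Hypothesis fopen : forall A : set G, open A <-> exists2 B : set H, open B & A = f @^-1` B.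
Hypothesis G_locally_minimal : locally_minimal G.
Local Open Scope group_scope.

Let K := closure (range f).

(** Such neighbourhoods intersect in a compact subgroup contained in [O]. *)
Lemma small_neighbourhoods (O : set H) : nbhs 1 O -> exists W : nat -> set H,
  [/\ forall n, nbhs 1 (W n), forall n, closed (W n), W 0%N `<=` O, compact (W 0%N) &
    forall n x y, W n.+1 x -> W n.+1 y -> W n (x * y^-1)].
Proof.
move=> O1.
have [C C1 Ccpt] : exists2 C : set H, nbhs 1 C & compact C.
  have [C C1 [cptC _]] := @lcH 1 I; exists C => //.
  have {}C1 : nbhs 1 [set x | [set: H] x -> C x] := C1.
  by apply: filterS C1 => x; exact.
have /choice[S SP] (V : {V : set H | nbhs 1 V}) : exists W : {W : set H | nbhs 1 W},
    closed (sval W) /\ forall x y, sval W x -> sval W y -> sval V (x * y^-1).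
  by have [W [W1 Wc WV]] := nbhs_divg_closed (svalP V); exists (exist _ W W1).
have CO1 : nbhs 1 (C `&` O) by exact: filterI.
pose W n := iter n.+1 S (exist _ (C `&` O) CO1).
have W0 : sval (W 0%N) `<=` C `&` O.
  move=> x Wx; have := (SP (exist _ _ CO1)).2 x 1 Wx (nbhs_singleton (svalP (W 0%N))).
  by rewrite invg1 mulg1.
exists (fun n => sval (W n)); split.
- by move=> n; exact: (svalP (W n)).
- by move=> n; exact: (SP _).1.
- by move=> x /W0[].
- by apply: (subclosed_compact _ Ccpt); [exact: (SP _).1|move=> x /W0[]].
- by move=> n x y; exact: (SP (W n)).2.
Qed.

(** Let [y i] be the points given by [spread_points] for a small compact subgroup
    [N] of the closure [K] of [G]; the points [g i] of [G] are taken in the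
    closed subgroups that they generate.  The intersection of the [W n] and of
    neighbourhoods of 1 in [H] whose traces on [N] are in the [Q i n] meets [K] in
    1 only; by compactness, their finite intersections give a local base. *)
Lemma locally_minimal_family : exists (I : Type) (g : I -> G),
  [/\ forall i, g i <> 0%R,
      forall V, nbhs (0%R : G) V -> finite_set [set i | ~ V (g i)] &
      exists B : set (set G), local_base 0%R B /\
        B #<= [set: seq (I * nat + nat)]].
Proof.
have [U [ oU U0] Umin] := G_locally_minimal.
have [ O oO UO] := (fopen U).1 oU.
have f0 : f 0%R = 1 := morph_zero fM.
have O1 : nbhs 1 O.
  by apply: open_nbhs_nbhs; split=> //; move: U0; rewrite UO /preimage /= f0.
have [W [W1 Wc W0O W0cpt WW]] := small_neighbourhoods O1.
pose N := K `&` \bigcap_n W n.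
have WS n x : W n.+1 x -> W n x.
  by move=> /WW/(_ (nbhs_singleton (W1 n.+1))); rewrite invg1 mulg1.
have N1 : N 1.
  by split; [exact: closure_range1|move=> n _; exact: nbhs_singleton].
have Ndiv x y : N x -> N y -> N (x * y^-1).
  move=> [Kx Wx] [Ky Wy]; split; first exact: closure_range_div.
  by move=> n _; apply: WW; [exact: Wx|exact: Wy].
have NC x y : N x -> N y -> x * y = y * x.
  by move=> [Kx _] [Ky _]; exact: (closure_rangeC hH fM).
have Nclosed : closed N.
  by apply: closedI; [exact: closed_closure|apply: closed_bigI => n _; exact: Wc].
have Ncpt : compact N.
  by apply: (subclosed_compact Nclosed W0cpt) => x [_]; exact.
pose A := AbelianSubgroup N1 Ndiv NC.
pose T : topologicalZmodType := abelian_type A.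
have [I [y [Q [y0 yV Q0 Qsep]]]] := @spread_points Rdefinitions.R T
  (@abelian_compact _ A Ncpt) (@abelian_hausdorff _ A hH).
pose D i : set H := closure (range (fun k : int => set_val (y i *~ k)%R)).
have Ddiv i x z : D i x -> D i z -> D i (x * z^-1).
  apply: closure_div => _ _ [k _ <-] [l _ <-]; exists (k - l)%R => //.
  by rewrite mulrzBr.
have DN i : D i `<=` N.
  rewrite (closure_id N).1 //; apply: closureS => _ [k _ <-]; exact: set_valP.
have D1 i : D i 1 by apply: subset_closure; exists 0%R => //; rewrite mulr0z.
have Dy i : D i (set_val (y i)) by apply: subset_closure; exists 1%R => //; rewrite mulr1z.
have /choice[g gP] i : exists g : G, D i (f g) /\ g <> 0%R.
  apply: contrapT => ng; have /eqP := y0 i; apply; apply: val_inj.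
  apply: (small_subgroup_trivial hH fM fopen _ (D1 i) (@Ddiv i) _ _
    Umin UO (W1 1%N) _ (Dy i)).
  - by move=> x /(DN i)[].
  - exact: closed_closure.
  - by move=> x Dx; apply: contrapT => x0; apply: ng; exists x.
  - move=> w d Ww Dd; apply: W0O; rewrite -[d]invgK; apply: WW => //.
    have Dd' : D i d^-1 by rewrite -[d^-1]mul1g; exact: Ddiv.
    by have [_] := DN i _ Dd'; apply.
have nbhsG (V : set G) : nbhs 0%R V -> exists2 B : set H, open B & B 1 /\ f @^-1` B `<=` V.
  rewrite nbhsE => -[V' [/fopen[B oB ->] B0] BV].
  by exists B => //; split=> //; move: B0; rewrite /preimage /= f0.
exists I, g; split.
- by move=> i; have [] := gP i.
- move=> V /nbhsG[B oB [B1 BV]].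
  have /nbhs_divg_closed[C [C1 Cc CB]] : nbhs 1 B by exact: (open_nbhs_nbhs (conj oB B1)).
  have C0 : nbhs (0%R : T) (set_val @^-1` C) by apply/nbhs_set_type; exists C.
  apply: sub_finite_set (yV _ C0) => i /= nV yC; apply: nV; apply: BV.
  have CfB : C `<=` B.
    by move=> x Cx; have := CB _ _ Cx (nbhs_singleton C1); rewrite invg1 mulg1.
  apply: CfB; have [+ _] := gP i; rewrite (closure_id C).1 //.
  by apply: closureS => _ [k _ <-]; exact: yC.
have /choice[C CP] (p : I * nat) : exists C : set H, [/\ nbhs 1 C, closed C &
    forall x : T, C (set_val x) -> Q p.1 p.2 x].
  have /nbhs_set_type[V V1 VQ] := Q0 p.1 p.2.
  have [C [C1 Cc CV]] := nbhs_divg_closed (V1 : nbhs 1 V); exists C; split=> // x Cx.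
  by apply: VQ; have := CV _ _ Cx (nbhs_singleton C1); rewrite invg1 mulg1.
pose E (c : I * nat + nat) := match c with inl p => C p | inr n => W n end.
have E1 c : nbhs 1 (E c) by case: c => [p|n] //=; have [] := CP p.
have Ec c : closed (E c) by case: c => [p|n] //=; have [] := CP p.
have Esep x : K x -> (forall c, E c x) -> x = 1.
  move=> Kx Ex; have Nx : N x by split=> // n _; exact: (Ex (inr n)).
  pose x' : T := exist _ x (mem_set Nx).
  have x'0 : x' = 0%R.
    by apply: Qsep => i n; have [_ _] := CP (i, n); apply; exact: (Ex (inl (i, n))).
  exact: (congr1 set_val x'0).
pose cap (s : seq (I * nat + nat)) : set H :=
  [set x | forall c, List.In c s -> E c x].
pose b (s : seq (I * nat + nat)) : set G := f @^-1` (cap s)°.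
exists (range b); split; last exact: card_image_le.
have Es s : nbhs 1 (cap s).
  elim: s => [|c s IHs]; first by apply: filterE => x c [].
  by apply: filterS2 (E1 c) IHs => x Ecx Esx d /= [<-//|]; exact: Esx.
split.
  move=> _ [s _ <-]; split; last by rewrite /b /preimage /= f0; exact: Es.
  by apply/fopen; exists (cap s)° => //; exact: open_interior.
move=> V /nbhsG[B oB [B1 BV]].
have cpt : compact (K `&` W 0%N `&` ~` B).
  apply: (subclosed_compact _ W0cpt); last by move=> x [[]].
  apply: closedI; last exact: open_closedC.
  by apply: closedI; [exact: closed_closure|exact: Wc].
have [x [[Kx _] nBx]|s sP] := compact_seq_cover (I := {classic (I * nat + nat)})
    (f := fun c => ~` E c) cpt.
  apply: contrapT => nc; apply: nBx; rewrite (Esep x) // => c.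
  apply: contrapT => nEc; apply: nc; exists c; apply: open_nbhs_nbhs; split=> //.
  by apply: closed_openC; exact: Ec.
have InP (c : {classic (I * nat + nat)}) t :
    c \in t -> List.In (c : (I * nat + nat)%type) t.
  by elim: t => [|d t IHt] //; rewrite inE => /orP[/eqP ->|/IHt]; [left|right].
(* The code [inr 0] adds the compact set [W 0] to the intersection. *)
exists (b (inr 0%N :: s)); first by exists (inr 0%N :: s).
move=> x /interior_subset bx; apply: BV; apply: contrapT => nBx.
have [|c cs] := sP (f x).
  by split=> //; split; [exact: range_sub_closure|exact: (bx (inr 0%N) (or_introl erefl))].
by apply; apply: bx; right; exact: InP.
Qed.

End locally_precompact_group.

(** * The super-sequence *)

Lemma point_character_le (X : topologicalType) (x : X) (B : set (set X)) (K : Type) :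
  local_base x B -> B #<= [set: K] -> [set: point_character x] #<= [set: K].
Proof.
move=> xB BK; have [_ least] := point_characterP x.
have := least (set_type B) (ex_intro2 _ _ B xB (card_setT_sym B)).
by rewrite (card_le_eqr (card_setT B)) => /card_le_trans; apply.
Qed.

Lemma point_character_translate (G : topologicalZmodType) (x : G) :
  [set: point_character x] #<= [set: point_character (0%R : G)].
Proof.
have [[B [Bopen Bbase] BK] _] := point_characterP (0%R : G).
have trans a : continuous (fun y : G => y + a)%R by exact: continuous_addr.
apply: (@point_character_le _ _ [set (fun y => y - x)%R @^-1` U | U in B]).
  split=> [_ [U /Bopen[ oU U0] <-]|V xV].
    split; last by rewrite /preimage /= subrr.
    by apply: open_comp => // y _; exact: trans.
  have : nbhs (0%R : G) ((fun y => y + x)%R @^-1` V) by apply: nbhs_addr; rewrite add0r.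
  move=> /Bbase[U BU UV]; exists ((fun y => y - x)%R @^-1` U); first by exists U.
  by move=> y /UV; rewrite /preimage /= subrK.
apply: card_le_trans (card_image_le _ _) _.
by move: BK; rewrite card_eq_le => /andP[].
Qed.

(** The [n]-th point is chosen in the intersection of the first [n] members of a
    countable base, which is not reduced to 0 in a non-discrete group. *)
Lemma first_countable_family (G : topologicalZmodType) (B : set (set G)) :
  ~ (forall A : set G, open A) -> local_base (0%R : G) B -> B #<= [set: nat] ->
  exists g : nat -> G, (forall n, g n <> 0%R) /\
    forall V, nbhs (0%R : G) V -> finite_set [set n | ~ V (g n)].
Proof.
move=> ndisc [Bopen Bbase] /card_le_trans/(_ (card_lexx _)) Bnat.
have [h hinj] : exists h : set G -> nat, {in B &, injective h}.
  exact/countable_injP.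
have /choice[b bP] n : exists V, nbhs (0%R : G) V /\ forall U, B U -> h U = n -> V `<=` U.
  have [[U [BU hU]]|nU] := pselect (exists U, B U /\ h U = n).
    exists U; split; first by apply: open_nbhs_nbhs; exact: Bopen.
    by move=> U' BU' hU'; rewrite (hinj U' U) ?inE // hU hU'.
  by exists setT; split=> [|U BU hU]; [exact: filterT|case: nU; exists U].
have inter n : nbhs (0%R : G) [set x | forall m, (m <= n)%N -> b m x].
  elim: n => [|n IHn].
    by apply: filterS (bP 0%N).1 => x bx m; rewrite leqn0 => /eqP ->.
  apply: filterS2 (bP n.+1).1 IHn => x bx bn m; rewrite leq_eqVlt => /orP[/eqP ->//|].
  exact: bn.
have non0 (V : set G) : nbhs 0%R V -> exists x, V x /\ x <> 0%R.
  move=> V0; apply: contrapT => nx; apply: ndisc => A; rewrite openE => x Ax.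
  have : nbhs x ((fun y => y - x)%R @^-1` V) by apply: nbhs_addr; rewrite subrr.
  apply: filterS => y Vyx; suff -> : y = x by [].
  apply/eqP; rewrite -subr_eq0; apply/eqP; apply: contrapT => yx.
  by apply: nx; exists (y - x)%R.
have /choice[g gP] n := non0 _ (inter n).
exists g; split=> [n|V /Bbase[U BU UV]]; first by have [] := gP n.
apply: (@sub_finite_set _ _ `I_(h U)) => [n /= nV|]; last exact: finite_II.
rewrite ltnNge; apply/negP => hn; apply: nV; apply: UV.
by have [+ _] := gP n => /(_ _ hn); apply: (bP (h U)).2.
Qed.

Theorem corollary7p3 (G : topologicalZmodType)
    (G_hausdorff : hausdorff_space G)
    (G_nondiscrete : ~ (forall A : set G, open A))
    (G_locally_minimal : locally_minimal G)
    (G_locally_precompact : locally_precompact G) :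
  (exists S : set G,
     super_sequence_to S (0%R : G) /\ S #= [set: character G]) /\
  [set: super_sequence_number G] #= [set: succ_card (character G)].
Proof.
have [[kinf kchar] kleast] := characterP G.
have [S [S0 Sinf Schar]] : exists S : set G, [/\ super_sequence_to S (0%R : G),
    infinite_set [set: set_type S] &
    [set: point_character (0%R : G)] #<= [set: set_type S]].
  have [H [f [hH lcH fM _ fopen]]] := G_locally_precompact.
  have [I [g [g0 gV [B [BP Bcard]]]]] :=
    locally_minimal_family hH lcH fM fopen G_locally_minimal.
  have BK (K : Type) : infinite_set [set: K] -> [set: I] #<= [set: K] -> B #<= [set: K].
    move=> Kinf IK; apply: card_le_trans Bcard _; apply: card_seq_le => //.
    apply: card_sum_le => //; last exact: card_nat_le.
    by apply: card_prod_le => //; exact: card_nat_le.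
  have [Ifin|Iinf] := pselect (finite_set [set: I]).
    have Bnat : B #<= [set: nat].
      by apply: BK; [exact: infinite_nat|exact: finite_set_countable].
    have [g' [g'0 g'V]] := first_countable_family G_nondiscrete BP Bnat.
    have [S [S0 Sinf nS]] := super_sequence_of_family G_hausdorff infinite_nat g'0 g'V.
    by exists S; split=> //; exact: point_character_le BP (card_le_trans Bnat nS).
  have [S [S0 Sinf IS]] := super_sequence_of_family G_hausdorff Iinf g0 gV.
  by exists S; split=> //; exact: point_character_le BP (BK _ Sinf IS).
have Sk : S #<= [set: character G] := super_sequence_card_le kinf (kchar _) S0.
have kS : [set: character G] #<= S.
  rewrite -(card_le_eqr (card_setT S)); apply: kleast; split=> // x.
  exact: card_le_trans (point_character_translate x) Schar.
split; first by exists S; split=> //; rewrite card_eq_le Sk.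
have [[ksucc nsucc] succ_least] := succ_cardP (character G).
have [[ninf nseq] number_least] := super_sequence_numberP G.
rewrite card_eq_le; apply/andP; split.
  apply: number_least; split.
    by move=> fin; apply: kinf; exact: card_le_finite ksucc fin.
  move=> [S' [x [S'x sS']]]; apply: nsucc; apply: card_le_trans sS' _.
  exact: super_sequence_card_le kinf (kchar x) S'x.
have nk : ~ ([set: super_sequence_number G] #<= [set: character G]).
  by move=> nk; apply: nseq; exists S, 0%R; split=> //; exact: card_le_trans nk kS.
apply: succ_least; split=> //.
by have [] := card_le_total (character G) (super_sequence_number G).
Qed.
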